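(* Let $f\in\mathrm{Diff}^1_{\mathrm{tw}}(\mathbf{T}^2)$ be area-preserving, and suppose that $\rho_V(\widehat f)=\{\alpha\}$ for some $\alpha\notin\mathbb{Q}$, where $\widehat f\in \mathrm{Diff}^1_{\mathrm{tw}}(\mathbf{T}^1\times\mathbb{R})$ is a lift of $f$. Then $f$ admits an invariant foliation $\mathcal{F}_G$; that is, there exist a constant $K>0$ and a foliation $\mathcal{F}_G$ of $\mathbf{T}^2$ by simple closed curves, all homotopic to $(1,0)$, each of which is the graph of a $K$-Lipschitz function $\mathbf{T}^1\to\mathbf{T}^1$ of the $x$-coordinate, such that $f(L_z)=L_{f(z)}$ for every $z\in\mathbf{T}^2$, where $L_z$ denotes the leaf of $\mathcal{F}_G$ containing $z$.
   Context: $\mathbf{T}^1=\mathbb{R}/\mathbb{Z}$, $\mathbf{T}^2=\mathbb{R}^2/\mathbb{Z}^2$; $p_1,p_2$ are the projections on the first and second coordinates (on $\mathbb{R}^2$, on $\mathbf{T}^1\times\mathbb{R}$ and on $\mathbf{T}^2$). $\mathrm{Diff}^1_{\mathrm{tw}}(\mathbf{T}^2)$ is the set of $C^1$-diffeomorphisms $f$ of $\mathbf{T}^2$ which, for some $\ell\in\mathbb{Z}\setminus\{0\}$, are homotopic to the Dehn twist $(x,y)\mapsto(x+\ell y \bmod 1, y\bmod 1)$ and satisfy the twist condition: there is $k_{tw}>0$ such that for any lift $\widetilde f:\mathbb{R}^2\to\mathbb{R}^2$ of $f$, $\frac{\ell}{|\ell|}\frac{\partial (p_1\circ\widetilde f)}{\partial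 \widetilde y}(\widetilde x,\widetilde y)>k_{tw}$ for all $(\widetilde x,\widetilde y)\in\mathbb{R}^2$. $\mathrm{Diff}^1_{\mathrm{tw}}(\mathbf{T}^1\times\mathbb{R})$ is the set of lifts of elements of $\mathrm{Diff}^1_{\mathrm{tw}}(\mathbf{T}^2)$ to the vertical cylinder $\mathbf{T}^1\times\mathbb{R}$. Area-preserving means preserving Lebesgue measure. The vertical rotation set is $\rho_V(\widehat f)=\bigcap_{i\ge1}\overline{\bigcup_{n\ge i}\left\{\frac{p_2\circ\widehat f^n(\widehat z)-p_2(\widehat z)}{n}:\widehat z\in\mathbf{T}^1\times\mathbb{R}\right\}}\subset\mathbb{R}$. *)

(* Defs.v *)
From HB Require Import structures.
From mathcomp Require Import all_boot all_order all_algebra.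
From mathcomp Require Import all_classical all_reals all_analysis.
From mathcomp Require Import generic_quotient ring_quotient.

Set Implicit Arguments.
Unset Strict Implicit.
Unset Printing Implicit Defensive.

Import Order.TTheory GRing.Theory Num.Theory.
Import numFieldNormedType.Exports.

Local Open Scope classical_set_scope.
Local Open Scope ring_scope.
Local Open Scope quotient_scope.

(* The subgroup Z of the additive group R. *)
Definition Zsub (R : realType) : zmodClosed R :=
  GRing.ZmodClosed.clone R Num.int_num_subdef _.

(* The circle R / Z, with its quotient group structure and quotient topology.
   The topology is rebuilt here because [quotient_topology] carries another
   [choiceType] structure, which does not join with the group structure. *)
Definition T1 (R : realType) : Type := ring_quotient.Quotient.quot (Zsub R).

HB.instance Definition _ (R : realType) := GRing.Zmodule.on (T1 R).
HB.instance Definition _ (R : realType) := EqQuotient.on (T1 R).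

Definition T1_open (R : realType) (U : set (T1 R)) : Prop :=
  open (\pi_(T1 R) @^-1` U : set R).

Lemma T1_openT (R : realType) : @T1_open R setT.
Proof. exact: openT. Qed.

Lemma T1_openI (R : realType) (A B : set (T1 R)) :
  T1_open A -> T1_open B -> T1_open (A `&` B).
Proof. exact: openI. Qed.

Lemma T1_open_bigU (R : realType) (I : Type) (f : I -> set (T1 R)) :
  (forall i, T1_open (f i)) -> T1_open (\bigcup_i f i).
Proof. by move=> fo; apply: bigcup_open => i _; exact: fo. Qed.

HB.instance Definition _ (R : realType) :=
  isOpenTopological.Build (T1 R) (@T1_openT R) (@T1_openI R) (@T1_open_bigU R).

(* R^2 / Z^2 is identified with (R / Z)^2. *)
Notation T2 R := (T1 R * T1 R)%type.

Definition piT1 (R : realType) (x : R) : T1 R := \pi_(T1 R) x.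

Definition piT2 (R : realType) (z : R * R) : T2 R := (piT1 z.1, piT1 z.2).

(* The covering of T^2 by the vertical cylinder T^1 x R. *)
Definition piC (R : realType) (z : T1 R * R) : T2 R := (z.1, piT1 z.2).

(* The quotient distance on R / Z. *)
Definition distT1 (R : realType) (x y : T1 R) : R :=
  inf [set `|a - b| | a in [set a | piT1 a = x] & b in [set b | piT1 b = y]].

Definition homotopic (R : realType) (X Y : topologicalType) (f g : X -> Y) :
    Prop :=
  exists H : R * X -> Y,
    [/\ {within `[0, 1]%classic `*` setT, continuous H},
        forall x, H (0, x) = f x & forall x, H (1, x) = g x].

Definition dehn_twist (R : realType) (l : int) (z : T2 R) : T2 R :=
  (z.1 + z.2 *~ l, z.2).

Definition plane_lift (R : realType) (f : T2 R -> T2 R) (F : R * R -> R * R) :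
    Prop :=
  continuous F /\ forall z, piT2 (F z) = f (piT2 z).

Definition cylinder_lift (R : realType) (f : T2 R -> T2 R)
    (fhat : T1 R * R -> T1 R * R) : Prop :=
  continuous fhat /\ forall z, piC (fhat z) = f (piC z).

Definition C1_plane (R : realType) (F : R * R -> R * R) : Prop :=
  (forall z, differentiable F z) /\
  (forall v, continuous (fun z => 'D_v F z)).

(* The C^1 structure of T^2 is the one that makes [piT2] a local
   diffeomorphism, and a continuous self-map of T^2 always has continuous lifts
   to the plane, any two of which differ by a constant. *)
Definition C1_torus (R : realType) (f : T2 R -> T2 R) : Prop :=
  exists2 F, plane_lift f F & C1_plane F.

Definition C1_diffeo (R : realType) (f : T2 R -> T2 R) : Prop :=
  C1_torus f /\
  exists g : T2 R -> T2 R, [/\ cancel f g, cancel g f & C1_torus g].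

Definition twist_condition (R : realType) (l : int) (f : T2 R -> T2 R) : Prop :=
  exists2 k : R, 0 < k &
    forall F, plane_lift f F ->
    forall x y : R,
      k < l%:~R / `|l%:~R| * derive1 (fun t : R => (F (x, t)).1) y.

Definition Diff1_tw (R : realType) : set (T2 R -> T2 R) :=
  [set f | C1_diffeo f /\
     exists l : int,
       [/\ l != 0, homotopic R f (@dehn_twist R l) & twist_condition l f]].

(* Lebesgue measure on T^2, computed in the fundamental domain [0, 1)^2. *)
Definition lebesgueT2 (R : realType) (A : set (T2 R)) : \bar R :=
  (@lebesgue_measure R \x @lebesgue_measure R)%E
    ((`[0, 1[%classic `*` `[0, 1[%classic) `&` @piT2 R @^-1` A).

Definition area_preserving (R : realType) (f : T2 R -> T2 R) : Prop :=
  forall A : set (T2 R), <<s [set U : set (T2 R) | open U] >> A ->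
    lebesgueT2 (f @^-1` A) = lebesgueT2 A.

Definition rhoV (R : realType) (fhat : T1 R * R -> T1 R * R) : set R :=
  \bigcap_(i in [set i : nat | (1 <= i)%N])
    closure (\bigcup_(n in [set n : nat | (i <= n)%N])
      [set ((iter n fhat z).2 - z.2) / n%:R | z in setT]).

(* [L z] is the leaf through [z] of a one-dimensional topological foliation:
   the leaves are path-connected and partition T^2, and around each point there
   is a chart (given by its inverse [psi], an open embedding of the plane) in
   which the connected components of the traces of the leaves are exactly the
   horizontal lines. *)
Definition foliation (R : realType) (L : T2 R -> set (T2 R)) : Prop :=
  [/\ forall z, L z z,
      forall z w, L z w -> L w = L z,
      forall z w, L z w -> exists g : R -> T2 R,
        [/\ {within `[0, 1], continuous g}, g 0 = z, g 1 = w &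
            forall t, 0 <= t <= 1 -> L z (g t)] &
      forall z, exists psi : R * R -> T2 R,
        [/\ continuous psi, injective psi,
            forall V, open V -> open (psi @` V),
            range psi z &
            forall p, connected_component (L (psi p) `&` range psi) (psi p) =
              psi @` [set q | q.2 = p.2]]].

(* A simple closed curve freely homotopic to the closed curve t |-> (t, 0) of
   homotopy class (1, 0). *)
Definition simple_closed_curve_10 (R : realType) (A : set (T2 R)) : Prop :=
  exists c : T1 R -> T2 R,
    [/\ continuous c, injective c, range c = A &
        homotopic R c (fun t : T1 R => (t, 0) : T2 R)].

Definition lipschitzT1 (R : realType) (K : R) (g : T1 R -> T1 R) : Prop :=
  forall x y, distT1 (g x) (g y) <= K * distT1 x y.

Definition lipschitz_graph (R : realType) (K : R) (A : set (T2 R)) : Prop :=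
  exists2 g : T1 R -> T1 R, lipschitzT1 K g & A = [set (x, g x) | x in setT].

Definition invariant_foliation (R : realType) (f : T2 R -> T2 R) : Prop :=
  exists (K : R) (L : T2 R -> set (T2 R)),
    [/\ 0 < K, foliation L,
        forall z, simple_closed_curve_10 (L z),
        forall z, lipschitz_graph K (L z) &
        forall z, f @` L z = L (f z)].

(* Main.v *)
(* Lift f to a map F of the plane. With upward jumps allowed at each
   step, one gets pseudo-orbits of F. By the twist condition a sequence of
   x-coordinates determines an orbit, and the orbit equation is a monotone
   recurrence whose subsolutions are the pseudo-orbits; Perron's method yields a
   true orbit above any of them with the same ends. True orbits climb at speed
   alpha, so comparing midpoints shows that no pseudo-orbit climbs more slowly,
   up to a bounded error.

   Hence H z = sup (height of z_0 + n alpha), over the pseudo-orbits z_0, ..., z_n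
   = z, is finite. It is lower semicontinuous, monotone in a cone (the image of a
   vertical has bounded slope), commutes with the deck translations and satisfies
   H (F z) >= H z + alpha. Poincare recurrence turns this into an equality. The
   level curves of H are then Lipschitz graphs permuted by F. They fill the plane
   because a gap would return to itself and make alpha rational, and two of them
   cannot meet because the twist would pull them apart. *)

From HB Require Import structures.
From mathcomp Require Import all_boot all_order all_algebra.
From mathcomp Require Import all_classical all_reals all_analysis.
From mathcomp Require Import zify ring lra.
Require Import Defs.

Set Implicit Arguments.
Unset Strict Implicit.
Unset Printing Implicit Defensive.

Import Order.TTheory GRing.Theory Num.Theory.
Import numFieldNormedType.Exports.

Local Open Scope classical_set_scope.
Local Open Scope ring_scope.

(** The hypothesis on the rotation set controls an orbit of length n only up to o(n), whereas a
    finite [H] needs an error bounded in n. The gain comes from closing up: a pseudo-orbit that ends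
    at a deck translate of its start can be repeated any number r of times, so a fixed deficit per
    period grows linearly in r and defeats the o(n). Closing up costs one bounded jump and one extra
    step, and this is the whole error. Jumps go upwards only, since this is what makes the
    x-coordinates a subsolution; the estimate is therefore one-sided. The opposite bound, for true
    orbits, is the same estimate for the map conjugated by z -> -z. The equality for [H] lives on
    both: gains of [H] accumulated at successive returns would push a true orbit above the upper
    bound. Upper semicontinuity is the delicate half of the continuity of [H], since a supremum of
    open conditions is only lower semicontinuous. It is what the disjointness of the leaves amounts
    to. *)

(** * Perron's method and pseudo-orbits of twist maps *)

(* Perron's method: the supremum of the subsolutions lying below [b] is a
   solution, because it could otherwise be raised at a single index. *)
Lemma perron (R : realType) (rho : R -> R -> R -> R) (Q : R) (N : nat)
    (u b : nat -> R) :
    0 < Q ->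
    (forall x x' v y y', x <= x' -> y <= y' -> rho x v y <= rho x' v y') ->
    (forall x v v' y, `|rho x v y - rho x v' y| <= Q * `|v - v'|) ->
    (forall n, u n <= b n) ->
    (forall n, (n.+2 <= N)%N -> 0 <= rho (u n) (u n.+1) (u n.+2)) ->
    (forall n, (n.+2 <= N)%N -> rho (b n) (b n.+1) (b n.+2) <= 0) ->
  exists w, [/\ forall n, u n <= w n, w 0%N = u 0%N, w N = u N &
    forall n, (n.+2 <= N)%N -> rho (w n) (w n.+1) (w n.+2) = 0].
Proof.
move=> Q0 rho_mono rho_lip ub usub bsup.
pose S := [set v : nat -> R | [/\ forall n, u n <= v n <= b n,
  v 0%N = u 0%N, v N = u N &
  forall n, (n.+2 <= N)%N -> 0 <= rho (v n) (v n.+1) (v n.+2)]].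
have Su : S u by split => // n; rewrite lexx ub.
pose A n := [set v n | v in S].
have A0 n : A n !=set0 by exists (u n), u.
have Aub n : has_ubound (A n).
  by exists (b n) => _ [v [vb _ _ _] <-]; case/andP: (vb n).
pose w n := sup (A n).
have w_ge v n : S v -> v n <= w n.
  by move=> Sv; apply: (ub_le_sup (Aub n)); exists v.
have w_le n : w n <= b n.
  by apply: ge_sup (A0 n) _ => _ [v [vb _ _ _] <-]; case/andP: (vb n).
have w_fix n : (forall v, S v -> v n = u n) -> w n = u n.
  move=> vE; apply/eqP; rewrite eq_le w_ge// andbT.
  by apply: ge_sup (A0 n) _ => _ [v Sv <-]; rewrite vE.
have w0 : w 0%N = u 0%N by apply: w_fix => v [].
have wN : w N = u N by apply: w_fix => v [].
have w_sub n : (n.+2 <= N)%N -> 0 <= rho (w n) (w n.+1) (w n.+2).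
  (* Passing from a subsolution [v] to [w] raises the outer arguments, which helps; only the middle
     one costs something, at most [Q] times its distance to the supremum. Hence the tolerance
     [e / Q]. *)
  move=> nN; apply/ler_addgt0Pr => e e0; rewrite -lerBlDr sub0r.
  have eQ : 0 < e / Q by rewrite divr_gt0.
  have [_ [v Sv <-] vw] := sup_adherent eQ (conj (A0 n.+1) (Aub n.+1)).
  rewrite -/(w _) in vw.
  have [_ _ _ /(_ _ nN) v0] := Sv.
  have h1 := rho_mono _ _ (v n.+1) _ _ (w_ge v n Sv) (w_ge v n.+2 Sv).
  have := rho_lip (w n) (w n.+1) (v n.+1) (w n.+2).
  rewrite ler_norml (ger0_norm (_ : 0 <= w n.+1 - v n.+1)) ?subr_ge0 ?w_ge//.
  move=> /andP[h2 _].
  have : Q * (w n.+1 - v n.+1) <= e.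
    rewrite -(@ler_pM2l _ Q^-1) ?invr_gt0// mulKf ?gt_eqF//; lra.
  lra.
exists w; split => // [n|n nN]; first exact: w_ge.
apply/eqP; rewrite eq_le w_sub// andbT leNgt; apply/negP => r0.
(* Where [w] touches the barrier it cannot be raised, but there monotonicity and the supersolution
   [b] already make [rho] nonpositive. *)
have [wb|wb] := eqVneq (w n.+1) (b n.+1).
  have := rho_mono _ _ (w n.+1) _ _ (w_le n) (w_le n.+2).
  rewrite wb in r0 * => h; have := bsup _ nN; lra.
set r := rho _ _ _ in r0.
(* The raise stays below [b] and lowers the positive value [r] by at most [r]; at the neighbouring
   indices it acts on an outer argument, where it can only help. *)
pose e := Num.min (b n.+1 - w n.+1) (r / Q).
have e0 : 0 < e by rewrite lt_min subr_gt0 lt_neqAle wb w_le divr_gt0.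
pose w' i := if i == n.+1 then w i + e else w i.
have ww' i : w i <= w' i by rewrite /w'; case: ifP => // _; lra.
suff /(w_ge w' n.+1) : S w' by rewrite /w' eqxx; lra.
split.
- move=> i; rewrite (le_trans (w_ge u i Su) (ww' i))/= /w'.
  case: ifP => [/eqP ->|_]; last exact: w_le.
  have : e <= b n.+1 - w n.+1 by rewrite ge_min lexx.
  lra.
- by rewrite /w'/= w0.
- by rewrite /w' (_ : (N == _) = false) ?wN//; apply/eqP => NE; rewrite NE ltnn in nN.
- move=> i iN; have [/eqP iE|iE] := boolP (i == n).
    subst i.
    have h1 := rho_mono _ _ (w' n.+1) _ _ (ww' n) (ww' n.+2).
    have := rho_lip (w n) (w' n.+1) (w n.+1) (w n.+2).
    rewrite ler_norml -/r => /andP[h2 _].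
    have wE : w' n.+1 - w n.+1 = e by rewrite /w' eqxx; lra.
    rewrite wE gtr0_norm// in h2.
    have : Q * e <= r.
      rewrite -(@ler_pM2l _ Q^-1) ?invr_gt0// mulKf ?gt_eqF// [_ * r]mulrC.
      by rewrite ge_min lexx orbT.
    lra.
  have -> : w' i.+1 = w i.+1 by rewrite /w' eqSS (negbTE iE).
  exact: le_trans (w_sub _ iN) (rho_mono _ _ _ _ _ (ww' _) (ww' _)).
Qed.

Lemma continuous_pair (T U V : topologicalType) (f : T -> U) (g : T -> V) :
  continuous f -> continuous g -> continuous (fun x => (f x, g x)).
Proof. by move=> cf cg x; apply: cvg_pair; [exact: cf|exact: cg]. Qed.

Lemma continuous_fst_comp (T U V : topologicalType) (f : T -> U * V) :
  continuous f -> continuous (fun x => (f x).1).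
Proof.
by move=> cf x; apply: (@continuous_comp _ _ _ f fst); [exact: cf|exact: cvg_fst].
Qed.

Lemma continuous_snd_comp (T U V : topologicalType) (f : T -> U * V) :
  continuous f -> continuous (fun x => (f x).2).
Proof.
by move=> cf x; apply: (@continuous_comp _ _ _ f snd); [exact: cf|exact: cvg_snd].
Qed.

Lemma shift_int (R : realType) (f : R -> R) (c : R) :
  (forall x, f (x + 1) = f x + c) ->
  forall a, a \is a Num.int -> forall x, f (x + a) = f x + a * c.
Proof.
move=> f1 a /intrP[m ->].
have fn (n : nat) x : f (x + n%:R) = f x + n%:R * c.
  elim: n => [|n IH]; first by rewrite addr0 mul0r addr0.
  by rewrite -natr1 addrA f1 IH; ring.
case: m => n x; first exact: fn.
by rewrite NegzE mulrNz -[in RHS](subrK (n.+1%:R) x) fn; ring.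
Qed.

Lemma sum_incr_ge (R : realDomainType) (g : nat -> R) (c : R) n :
  (forall k, (k < n)%N -> c <= g k.+1 - g k) -> n%:R * c <= g n - g 0%N.
Proof.
elim: n => [|n IH] gc; first by rewrite mul0r subrr.
have := IH (fun k kn => gc k (leqW kn)); have := gc n (leqnn _).
rewrite -natr1 mulrDl mul1r; lra.
Qed.

(* What is used of a lift to the plane of a twist map with inverse [G]; its
   differentiability only enters through these Lipschitz estimates. *)
Record twist_lift (R : realType) (l k L C : R) (F G : R * R -> R * R) : Prop :=
  TwistLift {
    tl_l : 0 < l;
    tl_int : l \is a Num.int;
    tl_k : 0 < k;
    tl_L : 0 <= L;
    tl_C : 0 <= C;
    tl_FK : cancel F G;
    tl_GK : cancel G F;
    tl_cF : continuous F;
    tl_cG : continuous G;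
    tl_x1 : forall x y, F (x + 1, y) = ((F (x, y)).1 + 1, (F (x, y)).2);
    tl_y1 : forall x y, F (x, y + 1) = ((F (x, y)).1 + l, (F (x, y)).2 + 1);
    tl_twist : forall x y1 y2, y1 <= y2 ->
      k * (y2 - y1) <= (F (x, y2)).1 - (F (x, y1)).1;
    tl_lipx : forall x1 x2 y,
      `|(F (x1, y)).1 - (F (x2, y)).1| <= L * `|x1 - x2|;
    tl_lipy : forall x y1 y2,
      `|(F (x, y1)).2 - (F (x, y2)).2| <= L * `|y1 - y2|;
    tl_bx : forall x y, `|(F (x, y)).1 - x - l * y| <= C;
    tl_by : forall x y, `|(F (x, y)).2 - y| <= C;
    tl_G : forall x y1 y2, y1 < y2 -> (G (x, y2)).1 < (G (x, y1)).1
  }.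

(** The o(n) form in which a rotation set reduced to [alpha] is used: uniform in the starting point,
    with [B] absorbing the small n. *)
Definition rotation (R : realType) (F : R * R -> R * R) (alpha : R) : Prop :=
  forall e, 0 < e -> exists B, forall n z,
    `|(iter n F z).2 - z.2 - n%:R * alpha| <= e * n%:R + B.

Section TwistLift.
Variables (R : realType) (l k L C : R) (F G : R * R -> R * R).
Hypothesis tl : twist_lift l k L C F G.

Lemma tl_shift a b x y : a \is a Num.int -> b \is a Num.int ->
  F (x + a, y + b) = ((F (x, y)).1 + a + l * b, (F (x, y)).2 + b).
Proof.
move=> az bz.
have h1 y' : (F (x + a, y')).1 = (F (x, y')).1 + a * 1.
  by apply: (shift_int (f := fun x => (F (x, y')).1)) => // x'; rewrite (tl_x1 tl).
have h2 y' : (F (x + a, y')).2 = (F (x, y')).2 + a * 0.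
  apply: (shift_int (f := fun x => (F (x, y')).2)) => // x'.
  by rewrite (tl_x1 tl)/= addr0.
have h3 : (F (x, y + b)).1 = (F (x, y)).1 + b * l.
  by apply: (shift_int (f := fun y => (F (x, y)).1)) => // y'; rewrite (tl_y1 tl).
have h4 : (F (x, y + b)).2 = (F (x, y)).2 + b * 1.
  by apply: (shift_int (f := fun y => (F (x, y)).2)) => // y'; rewrite (tl_y1 tl).
rewrite [LHS]surjective_pairing h1 h2 h3 h4; congr pair; ring.
Qed.

Lemma tl_iter_shift n a b x y : a \is a Num.int -> b \is a Num.int ->
  iter n F (x + a, y + b) =
  ((iter n F (x, y)).1 + a + n%:R * (l * b), (iter n F (x, y)).2 + b).
Proof.
move=> az bz; elim: n => [|n IH]; first by rewrite /= mul0r addr0.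
have lz := tl_int tl.
rewrite /= IH -addrA tl_shift// ?rpredD ?rpredM ?natr_int//.
by rewrite -surjective_pairing -natr1; congr pair; ring.
Qed.

Lemma tl_incr x y1 y2 : y1 < y2 -> (F (x, y1)).1 < (F (x, y2)).1.
Proof.
move=> y12; have := tl_twist tl x (ltW y12).
have : 0 < k * (y2 - y1) by rewrite mulr_gt0 ?subr_gt0// (tl_k tl).
lra.
Qed.

Lemma tl_cont1 x : continuous (fun y => (F (x, y)).1).
Proof.
apply: continuous_fst_comp => y.
apply: (@continuous_comp _ _ _ (fun y => (x, y)) F); last exact: (tl_cF tl).
apply: (@continuous_pair _ _ _ (fun=> x) id).
  by move=> ?; exact: cvg_cst.
by move=> ?; exact: cvg_id.
Qed.

Lemma tl_surj x x' : exists y, (F (x, y)).1 = x'.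
Proof.
have k0 := tl_k tl.
set f := fun y => (F (x, y)).1.
(* The twist moves the image by at least [k] per unit of height, so heights [d] and [- d] bracket
   [x']. *)
pose d := `|x' - f 0| / k.
have d0 : 0 <= d by rewrite divr_ge0// ltW.
have dE : k * d = `|x' - f 0| by rewrite /d mulrC divfK// gt_eqF.
have h1 := tl_twist tl x d0.
have h2 : k * (0 - (- d)) <= f 0 - f (- d) by apply: (tl_twist tl); rewrite oppr_le0.
rewrite sub0r opprK dE in h2; rewrite subr0 dE -!/(f _) in h1.
have h3 := ler_norm (x' - f 0); have h4 := lerNnormlW (lexx `|x' - f 0|).
have [|||y _ fy] := @IVT R f (- d) d x'; first lra.
- by apply: continuous_subspaceT => ?; exact: tl_cont1.
- by rewrite ge_min le_max; apply/andP; split; apply/orP; [left|right]; lra.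
by exists y.
Qed.

(** Two successive x-coordinates determine a point and its image: [Y] is the height of departure,
    [Y'] that of arrival. By [tl_surj] the default 0 is never taken. *)
Let Y x x' := xget 0 [set y | (F (x, y)).1 = x'].
Let Y' x x' := (F (x, Y x x')).2.

Let FY x x' : (F (x, Y x x')).1 = x'.
Proof. by have [y yP] := tl_surj x x'; rewrite /Y; case: xgetP => [? _ //|/(_ _ yP)]. Qed.

Let Y_uniq x y : Y x (F (x, y)).1 = y.
Proof.
have := FY x (F (x, y)).1.
by case: (ltgtP (Y x (F (x, y)).1) y) => // /(tl_incr x) => h ee; rewrite ee ltxx in h.
Qed.

Let FYY x x' : F (x, Y x x') = (x', Y' x x').
Proof. by rewrite [LHS]surjective_pairing FY. Qed.

Lemma tl_distY x y1 y2 : k * `|y1 - y2| <= `|(F (x, y1)).1 - (F (x, y2)).1|.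
Proof.
wlog y12 : y1 y2 / y2 <= y1.
  move=> h; case: (leP y2 y1) => [|/ltW] /h //.
  by rewrite distrC (distrC (F _).1).
by rewrite ger0_norm ?subr_ge0// (le_trans (tl_twist tl x y12)) ?ler_norm.
Qed.

Let Y_lip x v v' : k * `|Y x v - Y x v'| <= `|v - v'|.
Proof. by have := tl_distY x (Y x v) (Y x v'); rewrite !FY. Qed.

(** The preimage of a vertical is a Lipschitz graph: a change of x moves the image by at most [L]
    times as much, and y has to compensate at a rate of at least [k]. *)
Lemma tl_dist_same x1 y1 x2 y2 : (F (x1, y1)).1 = (F (x2, y2)).1 ->
  k * `|y1 - y2| <= L * `|x1 - x2|.
Proof.
move=> FE; apply: le_trans (tl_distY x1 y1 y2) _.
by rewrite FE distrC; exact: (tl_lipx tl).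
Qed.

Let Y_mono x v v' : v <= v' -> Y x v <= Y x v'.
Proof.
move=> vv'; rewrite leNgt; apply/negP => /(tl_incr x); rewrite !FY; lra.
Qed.

(** The inverse map tilts verticals to the left: on the vertical [v], the higher point comes from
    further left. *)
Let Y'_mono x x' v : x <= x' -> Y' x' v <= Y' x v.
Proof.
move=> xx'; rewrite leNgt; apply/negP => /(tl_G tl v).
rewrite -!FYY !(tl_FK tl)/=; lra.
Qed.

(** The jump at the middle of a sequence of x-coordinates x, v, y: zero along an orbit, nonnegative
    along a pseudo-orbit. This is the recurrence fed to [perron]. *)
Let rho x v y := Y v y - Y' x v.

Let rho_mono x x' v y y' : x <= x' -> y <= y' -> rho x v y <= rho x' v y'.
Proof. by move=> h1 h2; rewrite lerB ?Y_mono ?Y'_mono. Qed.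

(** Departure and arrival height each contribute [L / k]; the [+ 1] keeps the constant positive, as
    [perron] requires. *)
Let rho_lip x v v' y : `|rho x v y - rho x v' y| <= ((L + L) / k + 1) * `|v - v'|.
Proof.
have k0 := tl_k tl.
have h1 : `|Y v y - Y v' y| <= L / k * `|v - v'|.
  rewrite mulrAC ler_pdivlMr// mulrC.
  by apply: tl_dist_same; rewrite !FY.
have h2 : `|Y' x v' - Y' x v| <= L / k * `|v - v'|.
  apply: le_trans (tl_lipy tl _ _ _) _; rewrite -mulrA ler_wpM2l ?(tl_L tl)//.
  rewrite -(@ler_pM2l _ k)// mulVKf ?gt_eqF// distrC; exact: Y_lip.
rewrite /rho (_ : _ - _ = (Y v y - Y v' y) + (Y' x v' - Y' x v)); last by ring.
apply: le_trans (ler_normD _ _) _; have := normr_ge0 (v - v').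
rewrite mulrDl mul1r [(L + L) / k]mulrDl mulrDl; lra.
Qed.

(* A true orbit [w] lying above the pseudo-orbit [u] with the same ends has the
   larger midpoint, hence the smaller second difference; that of [w] is about
   [l m^2 alpha] and that of [u] is [l m^2 P / q]. *)
Lemma periodic_pseudo_orbit alpha (u v : nat -> R) (q : nat) (P : R) :
  rotation F alpha -> (0 < q)%N -> P \is a Num.int ->
  (forall n, u n.+1 = (F (u n, v n)).1) ->
  (forall n, (F (u n, v n)).2 <= v n.+1) ->
  (forall n, v (n + q)%N = v n + P) ->
  (forall n, u (n + q)%N - u n \is a Num.int) ->
  q%:R * alpha <= P.
Proof.
move=> rot q0 Pz uS vS vq uq; rewrite leNgt; apply/negP => Pq.
have l0 := tl_l tl; have k0 := tl_k tl; have C0 := tl_C tl.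
have qR : 0 < q%:R :> R by rewrite ltr0n.
(* Half the deficit per unit of time: up to [B], a true orbit still gains half of [q alpha - P] per
   period over the pseudo-orbit. *)
pose e := (q%:R * alpha - P) / (q%:R + q%:R).
have e0 : 0 < e by rewrite divr_gt0 ?subr_gt0// addr_gt0.
have eE : e * (q%:R + q%:R) = q%:R * alpha - P.
  by rewrite /e divfK// gt_eqF// addr_gt0.
clearbody e; have [B HB] := rot e e0.
pose g := l * (q%:R * alpha - P) / 2.
have g0 : 0 < g by rewrite divr_gt0// mulr_gt0// subr_gt0.
(* Enough periods for the gain [r * g] to exceed [l * B] and the two errors [C] made in reading
   heights off x-displacements. *)
pose r := (Num.bound `|(l * B + C + C) / g|).+1.
have rP : l * B + C + C < r%:R * g.
  rewrite -ltr_pdivrMr//; apply: le_lt_trans (ler_norm _) _.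
  by apply: lt_trans (archi_boundP (normr_ge0 _)) _; rewrite ltr_nat.
pose m := (q * r)%N.
have m0 : (0 < m)%N by rewrite muln_gt0 q0.
have vm n : v (n + m)%N = v n + r%:R * P.
  rewrite /m; elim: r {rP m m0} => [|r IH]; first by rewrite muln0 addn0 mul0r addr0.
  by rewrite mulnS [(q + _)%N]addnC addnA vq IH -natr1; ring.
have um n : u (n + m)%N - u n \is a Num.int.
  rewrite /m; elim: r {rP m m0 vm} => [|r IH]; first by rewrite muln0 addn0 subrr.
  rewrite mulnS [(q + _)%N]addnC addnA.
  rewrite -[u (_ + q)%N](subrK (u (n + q * r)%N)) -addrA.
  by rewrite rpredD ?uq.
have mE : m%:R = q%:R * r%:R :> R by rewrite -natrM.
clearbody m; pose N := (m + m)%N.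
(* The barrier is a concave parabola with second difference [- 2 c], which outweighs the errors
   [2 C + l C] in the recurrence. [Lam] lifts it above [u] up to [N]; beyond, it equals [u], since
   [perron] compares the two at every index. *)
pose c := C + l * C.
pose Lam := \sum_(i < N.+1) `|u i| + c * N%:R ^+ 2.
pose b n := if (n <= N)%N then Lam - c * n%:R ^+ 2 else u n.
have c0 : 0 <= c by rewrite addr_ge0// mulr_ge0// ltW.
have ub n : u n <= b n.
  rewrite /b; case: leqP => // nN.
  have h1 : u n <= \sum_(i < N.+1) `|u i|.
    rewrite (bigD1 (Ordinal (nN : (n < N.+1)%N)))//=.
    by rewrite (le_trans (ler_norm _))// lerDl sumr_ge0.
  have : c * n%:R ^+ 2 <= c * N%:R ^+ 2.
    by rewrite ler_wpM2l// lerXn2r ?nnegrE ?ler0n ?ler_nat.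
  by rewrite /Lam; lra.
have usub n : (n.+2 <= N)%N -> 0 <= rho (u n) (u n.+1) (u n.+2).
  move=> _; rewrite /rho /Y' (uS n.+1) Y_uniq (uS n) Y_uniq subr_ge0; exact: vS.
have bsup n : (n.+2 <= N)%N -> rho (b n) (b n.+1) (b n.+2) <= 0.
  move=> nN.
  have h x x' : `|x' - x - l * Y x x'| <= C.
    by have := tl_bx tl x (Y x x'); rewrite FY.
  have := h (b n) (b n.+1); have := h (b n.+1) (b n.+2).
  have := tl_by tl (b n) (Y (b n) (b n.+1)); rewrite -/(Y' _ _).
  rewrite !ler_norml => /andP[h1 _] /andP[h2 _] /andP[_ h3].
  have bE : b n.+2 - b n.+1 - (b n.+1 - b n) = - (c + c).
    rewrite /b nN (ltnW nN) (ltnW (ltnW nN)) -!natr1; ring.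
  rewrite -(@ler_pM2l _ l)// mulr0 /rho.
  have : l * (- C) <= l * (Y' (b n) (b n.+1) - Y (b n) (b n.+1)).
    by rewrite ler_wpM2l// ltW.
  have : 0 <= l * C by rewrite mulr_ge0// ltW.
  rewrite /c in bE; lra.
have Q0 : 0 < (L + L) / k + 1.
  by rewrite ltr_wpDl// divr_ge0 ?addr_ge0 ?(tl_L tl)// ltW.
have [w [uw w0 wN wrho]] := perron Q0 rho_mono rho_lip ub usub bsup.
pose y n := Y (w n) (w n.+1).
have zS n : (n.+2 <= N)%N -> F (w n, y n) = (w n.+1, y n.+1).
  move=> nN; rewrite /y FYY; congr pair; have := wrho n nN; rewrite /rho; lra.
have ziter j n : (n + j < N)%N -> iter j F (w n, y n) = (w (n + j)%N, y (n + j)%N).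
  elim: j => [|j IH] nj; first by rewrite addn0.
  by rewrite addnS in nj; rewrite /= (IH (ltnW nj)) zS// addnS.
have wy n : `|w n.+1 - w n - l * y n| <= C.
  by have := tl_bx tl (w n) (y n); rewrite /y FY.
(* The second difference of step [m] is a sum of [m] increments of [w (j + m) - w j], each about [l]
   times the climb of the true orbit over [m] steps. *)
have wdiff : m%:R * (l * (m%:R * alpha - e * m%:R - B) - C - C) <=
    (w N - w m) - (w m - w 0%N).
  pose gw j := w (j + m)%N - w j.
  rewrite (_ : (w N - w m) - _ = gw m - gw 0%N); last by rewrite /gw add0n; ring.
  apply: sum_incr_ge => j jm.
  have := HB m (w j, y j); rewrite ziter /=; last by rewrite ltn_add2r.
  have := wy (j + m)%N; have := wy j; rewrite /gw addSn.
  rewrite !ler_norml => /andP[_ h1] /andP[h2 _] /andP[h3 _].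
  have : l * (m%:R * alpha - e * m%:R - B) <= l * (y (j + m)%N - y j).
    by apply: ler_wpM2l; [exact: ltW|lra].
  lra.
have udiff : m%:R * (- (l * (r%:R * P))) <= - ((u N - u m) - (u m - u 0%N)).
  pose gu j := - (u (j + m)%N - u j).
  rewrite (_ : - ((u N - u m) - _) = gu m - gu 0%N); last by rewrite /gu add0n; ring.
  apply: sum_incr_ge => j jm.
  have := tl_shift (u j) (v j) (um j) (rpredM (natr_int _ r) Pz).
  rewrite -vm addrC subrK => /(congr1 fst) /=; rewrite -!uS /gu addSn => ->.
  lra.
have : m%:R * (l * (m%:R * alpha - e * m%:R - B) - C - C) <=
    m%:R * (l * (r%:R * P)).
  have := uw m; lra.
rewrite ler_pM2l ?ltr0n//.
rewrite mE.
have -> : e * (q%:R * r%:R) = (q%:R * alpha - P) / 2 * r%:R.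
  by rewrite -eE; field.
move: rP; rewrite /g; lra.
Qed.

End TwistLift.

(** * The height function *)

Lemma ceil_bounds (R : realType) (x : R) :
  exists2 a : R, a \is a Num.int & x <= a < x + 1.
Proof.
exists (Num.ceil x)%:~R; first exact: intr_int.
by have := gt_pred_ceil x; rewrite intrB ceil_ge/=; lra.
Qed.

(* [z] is the end of a pseudo-orbit [z_0, ..., z_n = z], with upward jumps, such
   that [s < z_0.2 + n alpha]. *)
Fixpoint reach (R : realType) (F : R * R -> R * R) (alpha : R) (n : nat)
    (s : R) (z : R * R) : Prop :=
  if n is n'.+1 then exists z',
    [/\ reach F alpha n' (s - alpha) z', z.1 = (F z').1 & (F z').2 <= z.2]
  else s < z.2.

Definition height (R : realType) (F : R * R -> R * R) (alpha : R) (z : R * R) :=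
  sup [set s | exists n, reach F alpha n s z].

(** Conjugation by the central symmetry, which keeps the twist but exchanges up and down: lower
    bounds for [negf F] are upper bounds for [F]. *)
Definition negf (R : realType) (F : R * R -> R * R) (z : R * R) := - F (- z).

Section Height.
Variables (R : realType) (l k L C : R) (F G : R * R -> R * R) (alpha : R).
Hypothesis tl : twist_lift l k L C F G.
Hypothesis rot : rotation F alpha.

(** [C] bounds the vertical move of the closing step, one unit is the jump before it, another the
    rounding to an integer, and [alpha] in absolute value pays for the extra step. *)
Let D := C + 2 + `|alpha|.

(* One more step, with a jump of size at most 1, brings the pseudo-orbit back
   to its starting point up to integer translations and a height at most
   [C + 2]; the resulting periodic pseudo-orbit cannot be slower than alpha. *)
Lemma pseudo_orbit_ge n (p : nat -> R * R) :
  (forall i, (i < n)%N -> (p i.+1).1 = (F (p i)).1 /\ (F (p i)).2 <= (p i.+1).2) ->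
  n%:R * alpha <= (p n).2 - (p 0%N).2 + D.
Proof.
move=> pS; have l0 := tl_l tl; have zl := tl_int tl.
have l1 : 1 <= l.
  have /natrP[m lE] : l \is a Num.nat by rewrite -intrEge0 ?ltW.
  by move: l0; rewrite lE ltr0n ler1n.
have [a az /andP[ha1 ha2]] := ceil_bounds ((F (p n)).1 - (p 0%N).1).
have [y yE] := tl_surj tl (p n).1 ((p 0%N).1 + a).
have pnE : p n = ((p n).1, (p n).2) by exact: surjective_pairing.
have y1 : (p n).2 <= y.
  by rewrite leNgt; apply/negP => /(tl_incr tl (p n).1); rewrite -pnE yE; lra.
(* Raising by one unit moves the image by [l >= 1], past the next integer translate of the starting
   vertical. *)
have y2 : y <= (p n).2 + 1.
  rewrite leNgt; apply/negP => /(tl_incr tl (p n).1).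
  by rewrite (tl_y1 tl) -pnE yE/=; lra.
have [P Pz /andP[hP1 hP2]] := ceil_bounds ((F ((p n).1, y)).2 - (p 0%N).2).
pose p' i := ((p i).1, if i == n then y else (p i).2).
have p'ge i : (p i).2 <= (p' i).2 by rewrite /p'/=; case: ifP => // /eqP ->.
(* Periodic extension with period [n.+1]: heights gain [P] per period, while the x-coordinates are
   generated by [F] and turn out to agree with those of [p] modulo 1. *)
pose v j := (p' (j %% n.+1)%N).2 + (j %/ n.+1)%:R * P.
pose u j := iteri j (fun i x => (F (x, v i)).1) (p 0%N).1.
have uS j : u j.+1 = (F (u j, v j)).1 by [].
have vE i j : (j < n.+1)%N -> v (i * n.+1 + j)%N = (p' j).2 + i%:R * P.
  by move=> jn; rewrite /v modnMDl modn_small// divnMDl// divn_small// addn0.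
have step i j : (j < n.+1)%N -> u (i * n.+1 + j)%N - (p j).1 \is a Num.int ->
    F (u (i * n.+1 + j)%N, v (i * n.+1 + j)%N) =
    ((F (p' j)).1 + (u (i * n.+1 + j)%N - (p j).1) + l * (i%:R * P),
     (F (p' j)).2 + i%:R * P).
  move=> jn uz; rewrite vE// -(tl_shift tl)// ?rpredM ?natr_int//.
  by rewrite [(p j).1 + _]addrC subrK.
have zlP i : l * (i%:R * P) \is a Num.int by rewrite !rpredM ?natr_int.
have uz i j : (j < n.+1)%N -> u (i * n.+1 + j)%N - (p j).1 \is a Num.int.
  have next i' j' : (j' < n)%N -> u (i' * n.+1 + j')%N - (p j').1 \is a Num.int ->
      u (i' * n.+1 + j'.+1)%N - (p j'.+1).1 \is a Num.int.
    move=> jn uz; rewrite addnS uS step 1?ltnW//=; have [-> _] := pS j' jn.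
    rewrite {1}/p' (ltn_eqF jn) -surjective_pairing.
    have -> (c d e : R) : c + d + e - c = d + e by ring.
    by rewrite rpredD ?zlP.
  elim: i j => [|i IHi]; elim=> [|j IHj] jn; rewrite ?next ?IHj ?(ltnW jn)//.
    by rewrite subrr.
  have -> : (i.+1 * n.+1 + 0)%N = (i * n.+1 + n).+1 by rewrite mulSn; lia.
  have uz := IHi n (leqnn _); rewrite uS step//= {1}/p' eqxx yE.
  have -> (c d e g : R) : c + d + e + g - c = d + e + g by ring.
  by rewrite rpredD ?zlP// rpredD.
have q0 : (0 < n.+1)%N by [].
have kE j : j = (j %/ n.+1 * n.+1 + j %% n.+1)%N by exact: divn_eq.
have vS j : (F (u j, v j)).2 <= v j.+1.
  rewrite (kE j); move: (j %/ _)%N (j %% _)%N (ltn_pmod j q0) => {}i {}j jn.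
  rewrite step ?uz//=; have [jE|jn'] := eqVneq j n.
    subst j; have -> : (i * n.+1 + n).+1 = (i.+1 * n.+1 + 0)%N by rewrite mulSn; lia.
    rewrite vE// {1}/p' eqxx -natr1.
    by have := p'ge 0%N; lra.
  have jn2 : (j < n)%N by rewrite ltn_neqAle jn'.
  rewrite -addnS vE// {1}/p' (negbTE jn') -surjective_pairing.
  have [_ h] := pS j jn2; have := p'ge j.+1; lra.
have vq j : v (j + n.+1)%N = v j + P.
  rewrite (kE j); move: (j %/ _)%N (j %% _)%N (ltn_pmod j q0) => {}i {}j jn.
  have -> : (i * n.+1 + j + n.+1)%N = (i.+1 * n.+1 + j)%N by rewrite mulSn; lia.
  by rewrite !vE// -natr1; ring.
have uq j : u (j + n.+1)%N - u j \is a Num.int.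
  rewrite (kE j); move: (j %/ _)%N (j %% _)%N (ltn_pmod j q0) => {}i {}j jn.
  have -> : (i * n.+1 + j + n.+1)%N = (i.+1 * n.+1 + j)%N by rewrite mulSn; lia.
  by rewrite -[X in X - _](subrK (p j).1) -addrA rpredD ?uz// -opprB rpredN uz.
have := periodic_pseudo_orbit tl rot q0 Pz uS vS vq uq.
have := tl_by tl (p n).1 y; rewrite ler_norml => /andP[_ h].
have := ler_norm (- alpha); rewrite normrN -natr1 /D; lra.
Qed.

Lemma reach_seq n s z : reach F alpha n s z -> exists p : nat -> R * R,
  [/\ p n = z, s - n%:R * alpha < (p 0%N).2 & forall i, (i < n)%N ->
    (p i.+1).1 = (F (p i)).1 /\ (F (p i)).2 <= (p i.+1).2].
Proof.
elim: n s z => [|n IH] s z /=.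
  by move=> sz; exists (fun=> z); split=> //; rewrite mul0r subr0.
move=> [z' [/IH[p [pn p0 pS]] z1 z2]].
exists (fun i => if (i <= n)%N then p i else z); split=> [||i].
- by rewrite ltnn.
- by rewrite /= -natr1; lra.
- rewrite ltnS => iN; rewrite iN; have [iE|iE] := eqVneq i n.
    by rewrite iE ltnn pn.
  by have iN' : (i < n)%N; [rewrite ltn_neqAle iE|rewrite iN'; exact: pS].
Qed.

Lemma reach_lt n s z : reach F alpha n s z -> s < z.2 + D.
Proof. by move=> /reach_seq[p [<- p0 /pseudo_orbit_ge]]; lra. Qed.

Lemma reach_up n s x y y' : reach F alpha n s (x, y) -> y <= y' ->
  reach F alpha n s (x, y').
Proof.
case: n => [|n] /= => [sy|[z' [z'r xE yE]]] yy'; first exact: lt_le_trans yy'.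
by exists z'; split => //; exact: le_trans yy'.
Qed.

(** The strict inequality at the start of a pseudo-orbit leaves room, so the supremum defining
    [height] is not attained; this makes [height_gtP] an equivalence. *)
Lemma reach_gt n s z : reach F alpha n s z ->
  exists2 s', s < s' & reach F alpha n s' z.
Proof.
elim: n s z => [|n IH] s z /=.
  by move=> sz; exists ((s + z.2) / 2); lra.
move=> [z' [/IH[s' ss' z'r] xE yE]]; exists (s' + alpha); first lra.
by exists z'; rewrite addrK.
Qed.

Lemma reach_anti n s s' z : s' <= s -> reach F alpha n s z -> reach F alpha n s' z.
Proof.
elim: n s s' z => [|n IH] s s' z ss' /=; first exact: le_lt_trans.
by move=> [z' [z'r xE yE]]; exists z'; split => //; apply: IH z'r; lra.
Qed.

(** Raise the last point before [z] until its image has moved right by [t]: the image moves right at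
    rate at least [k] and vertically at rate at most [L]. The twist allows this only to the
    right. *)
Lemma reach_cone n s x y t : 0 <= t -> reach F alpha n s (x, y) ->
  reach F alpha n s (x + t, y + L / k * t).
Proof.
have k0 := tl_k tl; have L0 := tl_L tl.
move=> t0; case: n => [|n] /=.
  by move=> sy; rewrite ltr_wpDr// mulr_ge0// divr_ge0// ltW.
move=> [[x1 y1] [z1r xE yE]]; have [y2 y2E] := tl_surj tl x1 (x + t).
have y12 : y1 <= y2.
  by rewrite leNgt; apply/negP => /(tl_incr tl x1); rewrite y2E; lra.
exists (x1, y2); split => //; first exact: reach_up z1r y12.
have h : L * (y2 - y1) <= L / k * t.
  rewrite -mulrA ler_wpM2l// [_^-1 * t]mulrC ler_pdivlMr// mulrC.
  by have := tl_twist tl x1 y12; rewrite y2E; lra.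
have := tl_lipy tl x1 y2 y1; rewrite (ger0_norm (_ : 0 <= y2 - y1)) ?subr_ge0//.
by rewrite ler_norml => /andP[_]; lra.
Qed.

Lemma reach_shift n s x y a b : a \is a Num.int -> b \is a Num.int ->
  reach F alpha n s (x, y) -> reach F alpha n (s + b) (x + a, y + b).
Proof.
move=> az bz; elim: n s x y a az => [|n IH] s x y a az /=; first by rewrite ltrD2r.
move=> [[x1 y1] [z1r xE yE]]; exists (x1 + (a - l * b), y1 + b).
have zlb : a - l * b \is a Num.int by rewrite rpredB// rpredM// (tl_int tl).
rewrite (tl_shift tl)//=; split; [|by rewrite xE; ring|by rewrite lerD2r].
have -> : s + b - alpha = s - alpha + b by ring.
exact: IH.
Qed.

Lemma open_reach n s : open [set z | reach F alpha n s z].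
Proof.
elim: n s => [|n IH] s /=.
  rewrite (_ : [set z | _] = snd @^-1` [set y : R | s < y])//.
  apply: open_comp; last exact: open_gt.
  by move=> z _; exact: cvg_snd.
(* Indexing by the size [j] of the last jump exhibits the set as a union of preimages under
   continuous maps. *)
pose g j (z : R * R) := G (z.1, z.2 - j).
rewrite (_ : [set z | _] = \bigcup_(j in [set j : R | 0 <= j])
    g j @^-1` [set z | reach F alpha n (s - alpha) z]).
  apply: bigcup_open => j _; apply: open_comp (IH _) => z _.
  apply: (@continuous_comp _ _ _ (fun z : R * R => (z.1, z.2 - j)) G).
    apply: continuous_pair => w; first exact: cvg_fst.
    by apply: cvgB; [exact: cvg_snd|exact: cvg_cst].
  exact: (tl_cG tl).
apply/seteqP; split=> -[x y] /=.
  move=> [z' [z'r xE yE]]; exists (y - (F z').2); rewrite /= ?subr_ge0// /g/=.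
  by rewrite opprB [y + _]addrC subrK xE -surjective_pairing (tl_FK tl).
move=> [j j0 gr]; exists (g j (x, y)); split => //; rewrite /g (tl_GK tl)//=.
by rewrite gerBl.
Qed.

Notation H := (height F alpha).

Lemma height_gtP s z : s < H z <-> exists n, reach F alpha n s z.
Proof.
have ubH : has_ubound [set s | exists n, reach F alpha n s z].
  by exists (z.2 + D) => r [n /reach_lt /ltW].
split=> [|[n /reach_gt[s' ss' z'r]]].
  by move=> /sup_gt -[|s' [n z'r] ss'];
    [exists (z.2 - 1), 0%N => /=; lra|exists n; apply: reach_anti (ltW ss') z'r].
by apply: lt_le_trans ss' (ub_le_sup ubH _); exists n.
Qed.

Let height_homo c z z' :
  (forall n s, reach F alpha n s z -> exists m, reach F alpha m (s + c) z') ->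
  H z + c <= H z'.
Proof.
move=> h; rewrite leNgt; apply/negP; rewrite -ltrBlDr => /height_gtP[n /h].
by rewrite subrK => /height_gtP; rewrite ltxx.
Qed.

Lemma height_ge z : z.2 <= H z.
Proof.
rewrite leNgt; apply/negP => Hz.
by have /height_gtP : exists n, reach F alpha n (H z) z; [exists 0%N|rewrite ltxx].
Qed.

Lemma height_le z : H z <= z.2 + D.
Proof. by rewrite leNgt; apply/negP => /height_gtP[n /reach_lt]; rewrite ltxx. Qed.

Lemma height_cone x y t y' : 0 <= t -> y + L / k * t <= y' ->
  H (x, y) <= H (x + t, y').
Proof.
move=> t0 yy'; rewrite -[H _]addr0; apply: height_homo => n s zr; exists n.
by rewrite addr0; apply: reach_up yy'; exact: reach_cone.
Qed.

Lemma height_shift x y a b : a \is a Num.int -> b \is a Num.int ->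
  H (x + a, y + b) = H (x, y) + b.
Proof.
move=> az bz; apply/eqP; rewrite eq_le -lerBlDr; apply/andP; split.
  apply: height_homo => n s zr; exists n.
  rewrite -[x in (x, _)](addrK a) -[y in (_, y)](addrK b).
  by apply: reach_shift => //; rewrite rpredN.
by apply: height_homo => n s zr; exists n; exact: reach_shift.
Qed.

Lemma open_height_gt s : open [set z | s < H z].
Proof.
rewrite (_ : [set z | _] = \bigcup_n [set z | reach F alpha n s z]).
  by apply: bigcup_open => n _; exact: open_reach.
by apply/seteqP; split=> z /= => [/height_gtP[n]|[n _ zr]]; [exists n|apply/height_gtP; exists n].
Qed.

Lemma height_F z : H z + alpha <= H (F z).
Proof.
by apply: height_homo => n s zr; exists n.+1, z; rewrite addrK.
Qed.

End Height.

(** Poincare recurrence on the torus, read in the plane: points come back to an open set up to a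
    deck translation. *)
Definition recurrent (R : realType) (F : R * R -> R * R) : Prop :=
  forall B : set (R * R), open B -> B !=set0 -> exists i z a b,
    [/\ (0 < i)%N, B z, a \is a Num.int, b \is a Num.int &
        B ((iter i F z).1 + a, (iter i F z).2 + b)].

Lemma open_square (R : realType) (B : set (R * R)) x y : open B -> B (x, y) ->
  exists2 e, 0 < e & forall x' y', `|x' - x| < e -> `|y' - y| < e -> B (x', y').
Proof.
move=> Bo Bz; have /nbhs_ballP[e /= e0 eB] := open_nbhs_nbhs (conj Bo Bz).
exists e => // x' y' hx hy; apply: eB; split; rewrite /ball/= distrC//.
Qed.

Lemma ltr_archi_absurd (R : realType) (g b : R) :
  0 < g -> ~ (forall n : nat, n%:R * g <= b).
Proof.
move=> g0 /(_ (Num.bound `|b / g|)); rewrite -ler_pdivlMr// leNgt => /negP; apply.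
exact: le_lt_trans (ler_norm _) (archi_boundP (normr_ge0 _)).
Qed.

Lemma iter_negf (R : realType) (F : R * R -> R * R) n z :
  iter n (negf F) (- z) = - iter n F z.
Proof. by elim: n => //= n ->; rewrite /negf opprK. Qed.

Lemma continuous_iter (T : topologicalType) (f : T -> T) n :
  continuous f -> continuous (iter n f).
Proof.
move=> cf; elim: n => [|n IH] x; first exact: cvg_id.
by apply: (@continuous_comp _ _ _ (iter n f) f); [exact: IH|exact: cf].
Qed.

Lemma iter_cancel (T : Type) (f g : T -> T) n :
  cancel f g -> cancel (iter n f) (iter n g).
Proof.
by move=> fK; elim: n => //= n IH x; rewrite iterSr iterS fK IH.
Qed.

(** * Equivariance of the height under the map *)

Section Equality.
Variables (R : realType) (l k L C : R) (F G : R * R -> R * R) (alpha : R).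
Hypothesis tl : twist_lift l k L C F G.
Hypothesis rot : rotation F alpha.

Lemma twist_lift_neg : twist_lift l k L C (negf F) (negf G).
Proof.
have cN (h : R * R -> R * R) : continuous h -> continuous (negf h).
  move=> ch; have c1 : continuous (fun z : R * R => h (- z)).
    move=> z; apply: (@continuous_comp _ _ _ (fun z : R * R => (- z.1, - z.2)) h).
      by apply: continuous_pair => ?; apply: cvgN; [exact: cvg_fst|exact: cvg_snd].
    exact: ch.
  apply: continuous_pair => z; apply: cvgN.
    exact: (continuous_fst_comp c1).
  exact: (continuous_snd_comp c1).
have FN x y : negf F (x, y) = (- (F (- x, - y)).1, - (F (- x, - y)).2) by [].
split; rewrite ?(tl_l tl) ?(tl_int tl) ?(tl_k tl) ?(tl_L tl) ?(tl_C tl)//.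
- by move=> z; rewrite /negf opprK (tl_FK tl) opprK.
- by move=> z; rewrite /negf opprK (tl_GK tl) opprK.
- exact/cN/(tl_cF tl).
- exact/cN/(tl_cG tl).
- move=> x y; rewrite !FN/= -[in RHS](subrK 1 (- x)) (tl_x1 tl)/= opprD.
  by congr pair; ring.
- move=> x y; rewrite !FN/= -[in RHS](subrK 1 (- y)) (tl_y1 tl)/= opprD.
  by congr pair; ring.
- move=> x y1 y2 y12; rewrite !FN/=.
  have : - y2 <= - y1 by rewrite lerN2.
  by move/(tl_twist tl (- x)); lra.
- move=> x1 x2 y; rewrite !FN/=.
  have -> (a b : R) : - a - - b = b - a by ring.
  have -> : x1 - x2 = - x2 - - x1 by ring.
  exact: (tl_lipx tl).
- move=> x y1 y2; rewrite !FN/=.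
  have -> (a b : R) : - a - - b = b - a by ring.
  have -> : y1 - y2 = - y2 - - y1 by ring.
  exact: (tl_lipy tl).
- move=> x y; rewrite !FN/= -normrN; have := tl_bx tl (- x) (- y).
  by have -> (a : R) : - (- a - x - l * y) = a - - x - l * - y by ring.
- move=> x y; rewrite !FN/= -normrN; have := tl_by tl (- x) (- y).
  by have -> (a : R) : - (- a - y) = a - - y by ring.
- move=> x y1 y2 y12; rewrite /negf /= ltrN2; apply: (tl_G tl).
  by rewrite ltrN2.
Qed.

Lemma rotation_neg : rotation (negf F) (- alpha).
Proof.
move=> e e0; have [B HB] := rot e0; exists B => n z; have := HB n (- z).
rewrite -[z in iter n (negf F) z]opprK iter_negf /= -normrN.
by have -> (a : R) : - (a - - z.2 - n%:R * alpha) = - a - z.2 - n%:R * - alpha by ring.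
Qed.

Let D := C + 2 + `|alpha|.

(** After conjugation by z -> -z a true orbit is still a pseudo-orbit, without jumps. Unlike in
    [rotation], the error is bounded in n. *)
Lemma orbit_le n z : (iter n F z).2 <= z.2 + n%:R * alpha + D.
Proof.
have := pseudo_orbit_ge twist_lift_neg rotation_neg (n := n)
  (p := fun i => iter i (negf F) (- z)).
rewrite iter_negf normrN => h; have := h (fun i _ => conj erefl (lexx _)).
by rewrite /= -/D; lra.
Qed.

Notation H := (height F alpha).

Lemma height_iter_ge n z : H z + n%:R * alpha <= H (iter n F z).
Proof.
elim: n => [|n IH]; first by rewrite mul0r addr0.
by have := height_F tl rot (iter n F z); rewrite -natr1 /=; lra.
Qed.

Hypothesis rec : recurrent F.

Let K := L / k.

Let K0 : 0 <= K.
Proof. by rewrite divr_ge0 ?(tl_L tl)// ltW// (tl_k tl). Qed.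

(* A gap at one point yields, by semicontinuity and monotonicity of [H], a
   uniform gap on an open set; returning to it often makes [H] outgrow the
   orbit. *)
Lemma height_eq z : H (F z) = H z + alpha.
Proof.
apply/eqP; rewrite eq_le (height_F tl rot) andbT leNgt; apply/negP => gap.
pose d := (H (F z) - (H z + alpha)) / 2.
have d0 : 0 < d by rewrite divr_gt0 ?subr_gt0.
have dE : d + d = H (F z) - (H z + alpha) by rewrite /d; field.
clearbody d.
pose O := F @^-1` [set w | H z + alpha + d < H w].
have Oo : open O.
  apply: open_comp; last exact: (open_height_gt tl rot).
  by move=> ? _; exact: (tl_cF tl).
have Oz : O (z.1, z.2) by rewrite -surjective_pairing /O/=; lra.
have [e e0 eO] := open_square Oo Oz.
(* Upper semicontinuity is not yet available. The bound [H w <= H z] near some point of [O] comes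
   instead from the cone property: points far enough below and to the left of [z] see [z] in their
   cone. *)
pose t := e / (2 * (K + 1)).
have K1 : 0 < 2 * (K + 1) by rewrite mulr_gt0// ltr_wpDl.
have t0 : 0 < t by rewrite divr_gt0.
have tE : t * (2 * (K + 1)) = e by rewrite /t divfK// gt_eqF.
clearbody t; have tK0 : 0 <= K * t by rewrite mulr_ge0// ltW.
pose B := O `&` [set w | H w <= H z]°.
have Bo : open B by apply: openI => //; exact: open_interior.
have B0 : B !=set0.
  exists (z.1 - t, z.2 - (K + 1) * t); split.
    apply: eO; rewrite addrAC subrr add0r normrN gtr0_norm ?mulr_gt0//; lra.
  have s0 : 0 < t / (2 * (K + 1)) by rewrite divr_gt0.
  pose s := t / (2 * (K + 1)).
  have sE : s * (2 * (K + 1)) = t by rewrite /s divfK// gt_eqF.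
  have {}s0 : 0 < s by [].
  clearbody s; have sK0 : 0 <= K * s by rewrite mulr_ge0// ltW.
  apply/nbhs_ballP; exists s => // -[x y] [].
  rewrite /ball/= !ltr_norml => /andP[x1 x2] /andP[y1 y2].
  rewrite (surjective_pairing z).
  have -> : z.1 = x + (z.1 - x) by ring.
  apply: (height_cone tl rot); first lra.
  have : K * (z.1 - x) <= K * (t + s) by rewrite ler_wpM2l//; lra.
  rewrite -/K; lra.
have Bgap w : B w -> H w + alpha + d <= H (F w).
  by move=> [Ow /interior_subset /= Hw]; move: Ow; rewrite /O/=; lra.
(* Quantifying over all open subsets lets the induction shrink [B'] to the points that have already
   made one return. *)
have main j B' : open B' -> B' !=set0 -> B' `<=` B ->
    exists w n, B' w /\ H w + n%:R * alpha + j%:R * d <= H (iter n F w).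
  elim: j B' => [|j IH] B' B'o B'0 B'B.
    by case: B'0 => w B'w; exists w, 0%N; rewrite /= !mul0r !addr0.
  have [i [w0 [a [b [i0 Bw0 az bz Bw1]]]]] := rec B'o B'0.
  (* The return map run backwards: it prolongs the orbit given by the induction hypothesis into the
     past by one more visit to [B'], worth [d]. *)
  pose psi (w : R * R) := iter i G (w.1 - a, w.2 - b).
  have psiK w : iter i F (psi w) = (w.1 - a, w.2 - b).
    exact: iter_cancel (tl_GK tl) _.
  have psiw : psi ((iter i F w0).1 + a, (iter i F w0).2 + b) = w0.
    by rewrite /psi/= !addrK -surjective_pairing iter_cancel//; exact: (tl_FK tl).
  have [|||w [n [[Bw Bpsi] Hw]]] := IH (B' `&` psi @^-1` B').
  - apply: openI => //; apply: open_comp => // u _.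
    apply: (@continuous_comp _ _ _ (fun w : R * R => (w.1 - a, w.2 - b))).
      apply: continuous_pair => ?; apply: cvgB; try exact: cvg_cst.
        exact: cvg_fst.
      exact: cvg_snd.
    by apply: continuous_iter; exact: (tl_cG tl).
  - by exists ((iter i F w0).1 + a, (iter i F w0).2 + b); split => //; rewrite /= psiw.
  - by move=> u [/B'B].
  exists (psi w), (n + i)%N; split => //; rewrite iterD psiK.
  have azN : - a \is a Num.int by rewrite rpredN.
  have bzN : - b \is a Num.int by rewrite rpredN.
  have cz : - a + n%:R * (l * - b) \is a Num.int.
    by rewrite rpredD// !rpredM ?natr_int// (tl_int tl).
  have hs : H ((iter n F w).1 - a + n%:R * (l * - b), (iter n F w).2 - b) =
      H (iter n F w) - b.
    by rewrite -addrA (height_shift tl rot)// -surjective_pairing.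
  rewrite (tl_iter_shift tl)// -surjective_pairing hs.
  have := psiK w; move: (psi w) (Bpsi : B' (psi w)) => w' Bw' w'E.
  have := height_iter_ge i.-1 (F w'); rewrite -iterSr prednK// w'E.
  rewrite (height_shift tl rot)// -surjective_pairing.
  have := Bgap _ (B'B _ Bw').
  rewrite -[i in (_ + i)%N]prednK// natrD -natr1 -[j.+1%:R]natr1; lra.
have D0 : 0 <= D by rewrite addr_ge0// addr_ge0// (tl_C tl).
apply: (@ltr_archi_absurd _ d (D + D) d0) => j.
have [w [n [_ Hw]]] := main j B Bo B0 (@subset_refl _ B).
have := height_le tl rot (iter n F w); have := height_ge tl rot w.
by have := orbit_le n w; rewrite -/D; lra.
Qed.
End Equality.

(** * Strict monotonicity and continuity of the height *)

Section Continuity.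
Variables (R : realType) (l k L C : R) (F G : R * R -> R * R) (alpha : R).
Hypothesis tl : twist_lift l k L C F G.
Hypothesis rot : rotation F alpha.
Hypothesis rec : recurrent F.
Hypothesis irr : forall n, (0 < n)%N -> n%:R * alpha \isn't a Num.int.

Notation H := (height F alpha).
Let D := C + 2 + `|alpha|.
Let K := L / k.

Let K0 : 0 <= K.
Proof. by rewrite divr_ge0 ?(tl_L tl)// ltW// (tl_k tl). Qed.

Let HF z : H (F z) = H z + alpha.
Proof. exact: height_eq tl rot rec z. Qed.

Lemma height_iter n z : H (iter n F z) = H z + n%:R * alpha.
Proof.
elim: n => [|n IH]; first by rewrite mul0r addr0.
by rewrite iterS HF IH -natr1; ring.
Qed.

Let H_up x y y' : y <= y' -> H (x, y) <= H (x, y').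
Proof.
move=> yy'; rewrite -[x in H (x, y')]addr0; apply: (height_cone tl rot) => //.
by rewrite mulr0 addr0.
Qed.

(** On the right this is the cone of pseudo-orbits. On the left, the preimage of a vertical is also
    [K]-Lipschitz; its point over [x'] has an image above [F (x, y)], and the equality for [H] pulls
    the comparison back. *)
Lemma height_lip x y x' y' : y + K * `|x' - x| <= y' -> H (x, y) <= H (x', y').
Proof.
have [xx'|xx'] := leP x x'.
  rewrite ger0_norm ?subr_ge0// => h; rewrite -[x'](subrK x) addrC.
  by apply: (height_cone tl rot) => //; rewrite subr_ge0.
rewrite ltr0_norm ?subr_lt0// opprB => yy'.
have [y2 y2E] := tl_surj tl x' (F (x, y)).1.
have h1 : H (x, y) <= H (x', y2).
  rewrite -(lerD2r alpha) -!HF [F (x, y)]surjective_pairing.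
  rewrite [F (x', y2)]surjective_pairing y2E; apply: H_up.
  rewrite leNgt; apply/negP => /(tl_G tl (F (x, y)).1).
  have -> : ((F (x, y)).1, (F (x', y2)).2) = F (x', y2).
    by rewrite -y2E -surjective_pairing.
  by rewrite -surjective_pairing !(tl_FK tl)/=; lra.
apply: le_trans h1 (H_up _ (le_trans _ yy')).
have := tl_dist_same tl y2E.
rewrite distrC (distrC x') (gtr0_norm (_ : 0 < x - x')) ?subr_gt0// => h.
have : `|y - y2| <= K * (x - x').
  by rewrite /K mulrAC ler_pdivlMr ?(tl_k tl)// mulrC.
by rewrite ler_norml; lra.
Qed.

(* [H] lies between its values at the two points on a ball around their midpoint. *)
Lemma recurrence_gap x y1 y2 : y1 < y2 -> exists i b,
  [/\ (0 < i)%N, b \is a Num.int &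
      `|i%:R * alpha + b| <= H (x, y2) - H (x, y1)].
Proof.
move=> y12; pose e := (y2 - y1) / (2 * (K + 1)).
have K1 : 0 < 2 * (K + 1) by rewrite mulr_gt0// ltr_wpDl.
have e0 : 0 < e by rewrite divr_gt0// subr_gt0.
have eE : e * (2 * (K + 1)) = y2 - y1 by rewrite /e divfK// gt_eqF.
clearbody e.
pose c : R * R := (x, (y1 + y2) / 2).
have HB z : ball c e z -> H (x, y1) <= H z <= H (x, y2).
  case: z => u v [] /=; rewrite /ball/= !ltr_norml => /andP[u1 u2] /andP[v1 v2].
  have : K * `|x - u| <= K * e.
    by rewrite ler_wpM2l// ler_norml; apply/andP; split; lra.
  move=> h; apply/andP; split; apply: height_lip; last lra.
  by rewrite distrC; lra.
have c0 : ball c e !=set0 by exists c; exact: ballxx.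
have [i [z [a [b [i0 Bz az bz Bz']]]]] := rec (ball_open c e) c0.
exists i, b; split => //.
move: (HB _ Bz) (HB _ Bz'); rewrite (height_shift tl rot)// -surjective_pairing.
by rewrite height_iter ler_norml => /andP[? ?] /andP[? ?]; apply/andP; split; lra.
Qed.

Lemma height_incr x y1 y2 : y1 < y2 -> H (x, y1) < H (x, y2).
Proof.
move=> y12; have [i [b [i0 bz]]] := recurrence_gap x y12.
move=> h; rewrite ltNge; apply/negP => H21; have := irr i0.
have : i%:R * alpha + b = 0 by apply/normr0_eq0/le_anti; rewrite normr_ge0 andbT; lra.
by move=> /eqP; rewrite addr_eq0 => /eqP ->; rewrite rpredN bz.
Qed.

(** Over a vertical segment of length 1, [H] grows by exactly 1, so one of [N] equal pieces carries
    less than [2 / N]; recurrence near its midpoint gives the return. *)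
Lemma small_return e : 0 < e -> exists i b,
  [/\ (0 < i)%N, b \is a Num.int & `|i%:R * alpha + b| < e].
Proof.
move=> e0; pose N := (Num.bound `|2 / e|).+1.
have N0 : 0 < N%:R :> R by rewrite ltr0n.
have Ne : 2 / N%:R < e.
  rewrite ltr_pdivrMr// mulrC -ltr_pdivrMr//; apply: le_lt_trans (ler_norm _) _.
  by apply: lt_trans (archi_boundP (normr_ge0 _)) _; rewrite ltr_nat.
pose g j := H (0, j%:R / N%:R).
have [j gj] : exists j, g j.+1 - g j < 2 / N%:R.
  apply/not_existsP => gN.
  have := @sum_incr_ge R g (2 / N%:R) N.
  have g1 : g N - g 0%N = 1.
    rewrite /g mul0r divff ?gt_eqF//.
    have := height_shift tl rot 0 0 (int_num0 R) (int_num1 R).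
    by rewrite !add0r => ->; ring.
  rewrite g1 [N%:R * _]mulrC divfK ?gt_eqF// => h.
  have : 2 <= 1 :> R by apply: h => i _; rewrite leNgt; apply/negP; exact: gN.
  lra.
have jj : j%:R / N%:R < j.+1%:R / N%:R :> R by rewrite ltr_pM2r ?invr_gt0// ltr_nat.
have [i [b [i0 bz h]]] := recurrence_gap 0 jj.
by exists i, b; split => //; apply: le_lt_trans h (lt_trans gj Ne).
Qed.

(* The boundary of [{H > s}]. *)
Let front s z := H z <= s /\ forall t, 0 < t -> s < H (z.1, z.2 + t).

Let front_shift s x y a b : a \is a Num.int -> b \is a Num.int ->
  front s (x, y) -> front (s + b) (x + a, y + b).
Proof.
move=> az bz [h1 h2]; split=> [|t t0]; first by rewrite (height_shift tl rot)// lerD2r.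
by rewrite /= addrAC (height_shift tl rot)// ltrD2r; exact: h2.
Qed.

(** A point above [F z] need not be the image of a point above [z], but images of points slightly
    above [z] lie in the cone below it. *)
Let front_F s z : front s z -> front (s + alpha) (F z).
Proof.
move=> [h1 h2]; split=> [|t t0]; first by rewrite HF lerD2r.
pose e := t / (K + 1).
have K1 : 0 < K + 1 by rewrite ltr_wpDl.
have e0 : 0 < e by rewrite divr_gt0.
have eE : e * (K + 1) = t by rewrite /e divfK// gt_eqF.
clearbody e.
have Oo : open (F @^-1` ball (F z) e).
  by apply: open_comp (ball_open _ _) => // ? _; exact: (tl_cF tl).
have Oz : (F @^-1` ball (F z) e) (z.1, z.2).
  by rewrite -surjective_pairing /=; exact: ballxx.
have [d d0 dO] := open_square Oo Oz.
have [] : (F @^-1` ball (F z) e) (z.1, z.2 + d / 2).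
  by apply: dO; rewrite ?subrr ?normr0// addrAC subrr add0r gtr0_norm; lra.
rewrite /ball/= => u1 u2.
apply: (@lt_le_trans _ _ (H (F (z.1, z.2 + d / 2)))).
  by rewrite HF ltrD2r h2// divr_gt0.
rewrite [F (_, _)]surjective_pairing; apply: height_lip.
have : K * `|(F z).1 - (F (z.1, z.2 + d / 2)).1| <= K * e by rewrite ler_wpM2l// ltW.
by move: u2; rewrite ltr_norml; lra.
Qed.

Let front_iter s z n : front s z -> front (s + n%:R * alpha) (iter n F z).
Proof.
move=> fz; elim: n => [|n IH]; first by rewrite mul0r addr0.
by rewrite -natr1 mulrDl mul1r addrA; exact: front_F.
Qed.

(* Raising [q] onto the vertical of [F p] would put [F q] above [F p], and the
   inverse map tilts verticals to the left. *)
Let front_mono s p q : front s p -> front s q -> p.1 <= q.1 ->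
  (F p).1 <= (F q).1.
Proof.
move=> [p1 p2] [q1 q2] pq; rewrite leNgt; apply/negP => Fqp.
have [y yE] := tl_surj tl q.1 (F p).1.
have qy : q.2 < y.
  rewrite ltNge; apply/negP; rewrite le_eqVlt => /orP[/eqP yq|/(tl_incr tl q.1)].
    by move: yE; rewrite yq -surjective_pairing; lra.
  by rewrite yE -surjective_pairing; lra.
have Hqy : H (F p) < H (F (q.1, y)).
  rewrite !HF ltrD2r (le_lt_trans p1)//.
  by have := q2 (y - q.2); rewrite subr_gt0 [q.2 + _]addrC subrK; exact.
have Fqy : ((F p).1, (F (q.1, y)).2) = F (q.1, y).
  by rewrite -yE -surjective_pairing.
have F2 : (F p).2 < (F (q.1, y)).2.
  rewrite ltNge; apply/negP => /(H_up (F p).1).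
  by rewrite Fqy -surjective_pairing; lra.
have := tl_G tl (F p).1 F2.
by rewrite Fqy -surjective_pairing !(tl_FK tl)/=; lra.
Qed.

Let front_iter_mono s p q n : front s p -> front s q -> p.1 <= q.1 ->
  (iter n F p).1 <= (iter n F q).1.
Proof.
move=> fp fq pq; elim: n => //= n IH.
exact: front_mono (front_iter n fp) (front_iter n fq) IH.
Qed.

Lemma iter_drift i : exists E, forall z,
  `|(iter i F z).1 - z.1 - i%:R * l * z.2| <= E.
Proof.
have l0 := tl_l tl; have C0 := tl_C tl.
elim: i => [|i [E HE]].
  by exists 0 => z /=; rewrite !mul0r subr0 subrr normr0.
exists (E + C + i%:R * l * C) => -[x y]; rewrite iterSr.
have := HE (F (x, y)); have := tl_bx tl x y; have := tl_by tl x y.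
rewrite !ler_norml /= => /andP[a1 a2] /andP[b1 b2] /andP[c1 c2].
have il : 0 <= i%:R * l by rewrite mulr_ge0// ltW.
have d1 := ler_wpM2l il a1; have d2 := ler_wpM2l il a2.
by rewrite -natr1; apply/andP; split; lra.
Qed.

(* Two leaves that meet at [z0] would force [z0] and a translate of [F^i z0] to
   lie on one leaf, along which [F] preserves the order; but the horizontal
   distance between their orbits grows linearly. *)
Lemma height_pinch z0 s : H z0 < s -> exists2 t, 0 < t & H (z0.1, z0.2 + t) < s.
Proof.
move=> Hs; apply: contrapT => pinch.
have Hge t : 0 < t -> s <= H (z0.1, z0.2 + t).
  by move=> t0; rewrite leNgt; apply/negP => h; apply: pinch; exists t.
have fz s' : H z0 <= s' -> s' < s -> front s' z0.
  by move=> h1 h2; split => // t t0; exact: lt_le_trans (Hge t t0).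
have [i [b [i0 bz ib]]] : exists i b, [/\ (0 < i)%N, b \is a Num.int &
    `|i%:R * alpha + b| < s - H z0] by apply: small_return; rewrite subr_gt0.
pose t := i%:R * alpha + b; rewrite -/t in ib.
have t0 : t != 0.
  apply/eqP => tE; have := irr i0; rewrite (_ : _ * _ = - b) ?rpredN ?bz//.
  by rewrite -[RHS]add0r -tE /t addrK.
(* [z0] is on the front of every level from [H z0] up to [s], and its translated image on those
   shifted by [t]. As [t] is smaller than [s - H z0], the two ranges meet, and [s1] is the least
   common level. *)
pose s1 := Num.max (H z0) (H z0 + t).
have [] : front s1 z0 /\ front s1 ((iter i F z0).1, (iter i F z0).2 + b).
  have fw s' : H z0 <= s' < s -> front (s' + t) ((iter i F z0).1, (iter i F z0).2 + b).
    move=> /andP[h1 h2].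
    have := front_iter i (fz _ h1 h2); rewrite [iter _ _ _]surjective_pairing.
    by move=> /(front_shift (int_num0 R) bz); rewrite addr0 -addrA.
  move: ib; rewrite ltr_norml => /andP[t1 t2].
  rewrite /s1; case: (leP (H z0) (H z0 + t)) => ht; split.
  - by apply: fz => //; lra.
  - by apply: fw; rewrite lexx.
  - exact: fz.
  - by rewrite -[X in front X](subrK t); apply: fw; apply/andP; split; lra.
set w := (_, _) => fz0 fw.
have [c cz cw] := ceil_bounds `|w.1 - z0.1|.
have c1 : `|w.1 - z0.1| <= c by case/andP: cw.
have cN : - c \is a Num.int by rewrite rpredN.
(* The horizontal translates of [w] by [- c] and [c] lie on the same front and enclose [z0]; the
   order on the front keeps them so. *)
have orders n : `|(iter n F w).1 - (iter n F z0).1| <= c.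
  have wc d : d \is a Num.int -> front s1 (w.1 + d, w.2 + 0).
    by move=> dz; rewrite -[s1]addr0; apply: front_shift => //; rewrite ?int_num0.
  move: c1; rewrite !ler_norml => /andP[c1 c2].
  have h1 : (iter n F (w.1 - c, w.2 + 0)).1 <= (iter n F z0).1.
    by apply: front_iter_mono (wc _ cN) fz0 _ => /=; lra.
  have h2 : (iter n F z0).1 <= (iter n F (w.1 + c, w.2 + 0)).1.
    by apply: front_iter_mono fz0 (wc _ cz) _ => /=; lra.
  move: h1 h2; rewrite !(tl_iter_shift tl) ?int_num0// -!surjective_pairing/=.
  by rewrite !mulr0 !addr0 => h1 h2; apply/andP; split; lra.
have [E HE] := iter_drift i.
have l0 := tl_l tl.
have il : 0 <= i%:R * l by rewrite mulr_ge0// ltW.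
pose M := c + E + i%:R * l * (D + `|H z0|).
(* The nth images of [z0] and [w] differ horizontally by [i l] times the height of the first, plus
   [n l b] from the translation, up to a constant. That height is [n alpha] up to a constant, so the
   sum is about [n l t]. *)
have bound n : `|n%:R * (l * t)| <= M.
  have := orders n; have := HE (iter n F z0).
  have wE : w = ((iter i F z0).1 + 0, (iter i F z0).2 + b) by rewrite addr0.
  rewrite wE (tl_iter_shift tl) ?int_num0// -surjective_pairing.
  rewrite -iterD addnC iterD /= addr0.
  have := height_ge tl rot (iter n F z0); have := height_le tl rot (iter n F z0).
  rewrite height_iter -/D => z2 z1.
  have := ler_norm (H z0); have := ler_norm (- H z0); rewrite normrN => n1 n2.
  rewrite !ler_norml => /andP[p1 p2] /andP[q1 q2].
  have d1 : i%:R * l * ((iter n F z0).2 - n%:R * alpha) <=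
      i%:R * l * (D + `|H z0|) by apply: ler_wpM2l => //; lra.
  have d2 : i%:R * l * (n%:R * alpha - (iter n F z0).2) <=
      i%:R * l * (D + `|H z0|) by apply: ler_wpM2l => //; lra.
  by rewrite /M /t; apply/andP; split; lra.
have g0 : 0 < `|l * t| by rewrite normr_gt0 mulf_neq0// gt_eqF.
apply: (ltr_archi_absurd (b := M) g0) => n.
by have := bound n; rewrite normrM normr_nat.
Qed.

Lemma continuous_height : continuous H.
Proof.
move=> z; apply/cvgrPdist_lt => e e0.
have Hz1 : H z - e < H z by lra.
have Hz2 : H z < H z + e by lra.
have [t t0 ht] := height_pinch Hz2.
have near1 : nbhs z [set w | H z - e < H w].
  by apply: open_nbhs_nbhs; split => //; exact: (open_height_gt tl rot).
have K1 : 0 < K + 1 by rewrite ltr_wpDl.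
pose d := t / (K + 1).
have d0 : 0 < d by rewrite divr_gt0.
have dE : d * (K + 1) = t by rewrite /d divfK// gt_eqF.
clearbody d.
apply: filterS2 near1 (nbhsx_ballx z d d0) => -[x y] /= h1 [].
rewrite /ball/= => /ltW u1 u2.
have : H (x, y) <= H (z.1, z.2 + t).
  apply: height_lip; have := ler_wpM2l K0 u1.
  by move: u2; rewrite ltr_norml; lra.
by rewrite ltr_norml => h2; apply/andP; split; lra.
Qed.

End Continuity.

(** * The torus as a quotient of the plane *)

Lemma continuous_prod (S T U V : topologicalType) (f : S -> U) (g : T -> V) :
  continuous f -> continuous g ->
  continuous (fun z : S * T => (f z.1, g z.2)).
Proof.
move=> cf cg; apply: continuous_pair => z.
  by apply: (@continuous_comp _ _ _ fst f); [exact: cvg_fst|exact: cf].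
by apply: (@continuous_comp _ _ _ snd g); [exact: cvg_snd|exact: cg].
Qed.

Lemma continuous_comp2 (T U V : topologicalType) (f : T -> U) (g : U -> V) :
  continuous f -> continuous g -> continuous (fun x => g (f x)).
Proof. by move=> cf cg x; apply: (@continuous_comp _ _ _ f g); [exact: cf|exact: cg]. Qed.

Definition open_map (T U : topologicalType) (f : T -> U) : Prop :=
  forall V, open V -> open (f @` V).

Lemma open_map_nbhs (T U : topologicalType) (f : T -> U) x (P : set T) :
  open_map f -> nbhs x P -> nbhs (f x) (f @` P).
Proof.
move=> fo xP; have : nbhs (f x) (f @` P°).
  apply: open_nbhs_nbhs; split; first exact: fo (open_interior _).
  by exists x => //; exact: nbhs_singleton (nbhs_interior xP).
by apply: filterS => _ [y /interior_subset Py <-]; exists y.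
Qed.

Lemma open_map_prod (S T U V : topologicalType) (f : S -> U) (g : T -> V) :
  open_map f -> open_map g -> open_map (fun z : S * T => (f z.1, g z.2)).
Proof.
move=> fo go W Wo; rewrite openE => _ [z Wz <-].
have [[P Q] /= [zP zQ] PQ] := open_nbhs_nbhs (conj Wo Wz).
exists (f @` P, g @` Q).
  by split=> /=; [exact: open_map_nbhs fo zP|exact: open_map_nbhs go zQ].
move=> [_ _] [/= [x Px <-] [y Qy <-]]; exists (x, y) => //.
exact: PQ.
Qed.

Lemma open_map_comp (S T U : topologicalType) (f : S -> T) (g : T -> U) :
  open_map f -> open_map g -> open_map (g \o f).
Proof. by move=> fo go V Vo; rewrite -image_comp; apply: go; exact: fo. Qed.

Lemma continuous_open_quotient (T U V : topologicalType) (p : T -> U)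
    (g : U -> V) :
  open_map p -> (forall u, exists t, p t = u) -> continuous (fun t => g (p t)) ->
  continuous g.
Proof.
move=> po ps /continuousP cg; apply/continuousP => A Ao.
rewrite (_ : g @^-1` A = p @` ((fun t => g (p t)) @^-1` A)); first exact/po/cg.
apply/seteqP; split=> [u Au|_ [t At <-]] //.
by have [t tu] := ps u; exists t => //; rewrite /= tu.
Qed.

Section Torus.
Variable R : realType.
Local Open Scope quotient_scope.

Lemma piT1_eqP (x y : R) : piT1 x = piT1 y <-> x - y \is a Num.int.
Proof.
have xyE := ring_quotient.Quotient.idealrBE (Zsub R) x y.
split=> [xy|xy].
  suff : x - y \in Zsub R by [].
  by rewrite xyE; apply/eqP.
by apply/eqP; rewrite /piT1 -xyE.
Qed.

Lemma piT1D (x y : R) : piT1 (x + y) = piT1 x + piT1 y.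
Proof. exact: (raddfD (\pi_(T1 R))). Qed.

Lemma piT1B (x y : R) : piT1 (x - y) = piT1 x - piT1 y.
Proof. exact: (raddfB (\pi_(T1 R))). Qed.

Lemma piT1Mz (x : R) m : piT1 (x *~ m) = piT1 x *~ m.
Proof. exact: (raddfMz (\pi_(T1 R))). Qed.

Lemma piT1_0 : piT1 (0 : R) = 0.
Proof. exact: (raddf0 (\pi_(T1 R))). Qed.

Lemma piT1_surj (p : T1 R) : exists x, piT1 x = p.
Proof. by exists (repr p); rewrite /piT1 reprK. Qed.

Lemma piT1_int (x a : R) : a \is a Num.int -> piT1 (x + a) = piT1 x.
Proof. by move=> az; apply/piT1_eqP; rewrite addrC addKr. Qed.

Lemma piT2_surj (p : T2 R) : exists z, piT2 z = p.
Proof.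
case: p => p q; have [x <-] := piT1_surj p; have [y <-] := piT1_surj q.
by exists (x, y).
Qed.

Lemma piT2_eqP (z w : R * R) : piT2 z = piT2 w <->
  exists a b, [/\ a \is a Num.int, b \is a Num.int & z = (w.1 + a, w.2 + b)].
Proof.
split=> [[/piT1_eqP h1 /piT1_eqP h2]|[a [b [az bz ->]]]].
  exists (z.1 - w.1), (z.2 - w.2); split => //.
  by rewrite addrC subrK addrC subrK; exact: surjective_pairing.
by rewrite /piT2/= !piT1_int.
Qed.

Lemma continuous_piT1 : continuous (@piT1 R).
Proof. by apply/continuousP. Qed.

Lemma open_piT1 : open_map (@piT1 R).
Proof.
move=> V Vo; suff : open (@piT1 R @^-1` (@piT1 R @` V)) by [].
rewrite (_ : _ @^-1` _ = \bigcup_(a in [set a : R | a \is a Num.int])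
    (fun x => x - a) @^-1` V).
  apply: bigcup_open => a _; apply: open_comp => // x _.
  by apply: cvgB; [exact: cvg_id|exact: cvg_cst].
apply/seteqP; split=> [x [y Vy /piT1_eqP h]|x [a az Vx]] /=.
  by exists (x - y); rewrite /= ?subKr// -opprB rpredN.
by exists (x - a) => //; rewrite piT1_int ?rpredN.
Qed.

Lemma continuous_piT2 : continuous (@piT2 R).
Proof. exact: continuous_prod continuous_piT1 continuous_piT1. Qed.

Lemma open_piT2 : open_map (@piT2 R).
Proof. exact: open_map_prod open_piT1 open_piT1. Qed.

Lemma continuous_T1 (V : topologicalType) (g : T1 R -> V) :
  continuous (fun x => g (piT1 x)) -> continuous g.
Proof. exact: continuous_open_quotient open_piT1 piT1_surj. Qed.

Lemma continuous_T2 (V : topologicalType) (g : T2 R -> V) :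
  continuous (fun z => g (piT2 z)) -> continuous g.
Proof. exact: continuous_open_quotient open_piT2 piT2_surj. Qed.

Lemma continuous_subT1 : continuous (fun p : T2 R => p.1 - p.2).
Proof.
apply: continuous_T2; rewrite (_ : (fun z => _) = fun z => piT1 (z.1 - z.2)).
  apply: continuous_comp2 continuous_piT1 => z.
  by apply: cvgB; [exact: cvg_fst|exact: cvg_snd].
by apply/funext => z; rewrite piT1B.
Qed.

Lemma int_valued_const (g : R -> R) : continuous g ->
  (forall x, g x \is a Num.int) -> forall x y, g x = g y.
Proof.
move=> cg gz; suff lt_false x y : g x < g y -> False.
  by move=> x y; case: (ltgtP (g x) (g y)) => // /lt_false.
move=> gxy; have [a az /andP[a1 a2]] := ceil_bounds (g x).
(* A value of [g] by the intermediate value theorem, strictly between [g x] and [g x + 1]: not an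
   integer. *)
pose v := (g x + Num.min (g y) (g x + 1)) / 2.
have v1 : g x < v.
  rewrite /v; case: (leP (g y) (g x + 1)) => ?; lra.
have v2 : v < g y.
  rewrite /v; case: (leP (g y) (g x + 1)) => ?; lra.
have v3 : v < g x + 1.
  rewrite /v; case: (leP (g y) (g x + 1)) => ?; lra.
have [c gc] : exists c, g c = v.
  have [xy|/ltW xy] := leP x y.
    have [||c _ gc] := @IVT R g x y v xy; last by exists c.
      by apply: continuous_subspaceT.
    by rewrite ge_min le_max (ltW v1) (ltW v2) orbT.
  have [||c _ gc] := @IVT R g y x v xy; last by exists c.
    by apply: continuous_subspaceT.
  by rewrite ge_min le_max (ltW v1) (ltW v2) orbT.
have /intrP[m mE] : g c - g x \is a Num.int by rewrite rpredB.
have m0 : (0 < m) by rewrite -(ltr0z R) -mE gc subr_gt0.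
have m1 : (m < 1) by rewrite -(ltrz1 R) -mE gc; lra.
by move: m m0 m1 {mE} => [[|m]|m].
Qed.

Lemma int_valued_const2 (g : R * R -> R) : continuous g ->
  (forall z, g z \is a Num.int) -> forall z w, g z = g w.
Proof.
move=> cg gz z w.
pose h t := g (z.1 + t * (w.1 - z.1), z.2 + t * (w.2 - z.2)).
have ch : continuous h.
  apply: continuous_comp2 cg; apply: continuous_pair => t.
    by apply: cvgD; [exact: cvg_cst|apply: cvgM; [exact: cvg_id|exact: cvg_cst]].
  by apply: cvgD; [exact: cvg_cst|apply: cvgM; [exact: cvg_id|exact: cvg_cst]].
have := int_valued_const ch (fun t => gz _) 0 1.
rewrite /h !mul0r !addr0 !mul1r -surjective_pairing.
by rewrite addrC subrK addrC subrK -surjective_pairing.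
Qed.

(** A section of the covering over an arc around 0, unique because two candidates differ by less
    than 1. It lifts the difference of two nearby loops. *)
Definition arc_lift (p : T1 R) : R :=
  xget 0 [set r | `|r| < 1 / 4 /\ piT1 r = p].

Definition arc : set (T1 R) := @piT1 R @` [set r | `|r| < 1 / 4].

Lemma arc_liftP p : arc p -> `|arc_lift p| < 1 / 4 /\ piT1 (arc_lift p) = p.
Proof.
move=> [r r1 rp]; rewrite /arc_lift; case: xgetP => [_ _ //|/(_ r)].
by case; split.
Qed.

Lemma arc_lift_piT1 r : `|r| < 1 / 4 -> arc_lift (piT1 r) = r.
Proof.
move=> r1; have [] := @arc_liftP (piT1 r); first by exists r.
move=> + /piT1_eqP /intrP[m mE].
move: r1; rewrite !ltr_norml => /andP[a1 a2] /andP[b1 b2].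
have m1 : (m < 1) by rewrite -(ltrz1 R) -mE; lra.
have m2 : (-1 < m) by rewrite -(ltr_int R) -mE/=; lra.
have : m = 0 by lia.
by move=> m0; move: mE; rewrite m0 => /eqP; rewrite subr_eq0 => /eqP.
Qed.

Lemma open_arc : open arc.
Proof.
apply: open_piT1; rewrite (_ : [set r | _] = ball 0 (1 / 4)); first exact: ball_open.
by apply/seteqP; split=> r; rewrite /ball/= sub0r normrN.
Qed.

Lemma continuous_arc_lift (T : topologicalType) (e : T -> T1 R) :
  continuous e -> (forall t, arc (e t)) -> continuous (fun t => arc_lift (e t)).
Proof.
move=> ce earc t; apply/cvgrPdist_lt => d d0.
have [r1 rE] := arc_liftP (earc t); set r := arc_lift (e t) in r1 rE *.
pose V := @piT1 R @` [set s : R | `|s| < 1 / 4 /\ `|r - s| < d].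
have Vo : open V.
  apply: open_piT1.
  rewrite (_ : [set s | _] = ball 0 (1 / 4) `&` ball r d).
    by apply: openI; exact: ball_open.
  by apply/seteqP; split=> s; rewrite /ball/= sub0r normrN.
have tV : nbhs (e t) V.
  by apply: open_nbhs_nbhs; split => //; exists r => //; split => //; rewrite subrr normr0.
apply: (@filterS _ (nbhs t) _ (e @^-1` V)); last exact: ce tV.
by move=> t' [s [s1 s2] /= <-]; rewrite arc_lift_piT1.
Qed.

Lemma arcN p : arc p -> arc (- p).
Proof.
by move=> [r r1 <-]; exists (- r); rewrite /= ?normrN// -[- r]sub0r piT1B piT1_0 sub0r.
Qed.

Lemma int_to_unit (t : R) : exists2 t', 0 <= t' <= 1 & t - t' \is a Num.int.
Proof.
have [a az /andP[a1 a2]] := ceil_bounds (t - 1).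
by exists (t - a); [apply/andP; split; lra|rewrite subKr].
Qed.

(** Having a lift of degree [d] is locally constant in the parameter: by compactness of the period,
    nearby loops differ by a loop in the arc, whose lift is periodic. The indicator of this property
    is continuous and integer-valued, hence constant. Two lifts of one loop differ by a constant. *)
Lemma degree_homotopy (K : R * R -> T1 R) (s0 s1 : R) (k0 k1 : R -> R) (d : R) :
  continuous K -> (forall s t, K (s, t + 1) = K (s, t)) ->
  continuous k0 -> (forall t, piT1 (k0 t) = K (s0, t)) ->
  continuous k1 -> (forall t, piT1 (k1 t) = K (s1, t)) ->
  (forall t, k0 (t + 1) = k0 t + d) -> forall t, k1 (t + 1) = k1 t + d.
Proof.
move=> cK K1 ck0 k0E ck1 k1E k0S.
pose good s := exists k, [/\ continuous k, forall t, piT1 (k t) = K (s, t) &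
  forall t, k (t + 1) = k t + d].
have Kint s t a : a \is a Num.int -> K (s, t + a) = K (s, t).
  move=> /intrP[m ->]; have Kn (n : nat) u : K (s, u + n%:R) = K (s, u).
    elim: n => [|n IH]; first by rewrite addr0.
    by rewrite -natr1 addrA K1.
  case: m => n; first exact: Kn.
  by rewrite NegzE mulrNz -[in RHS](subrK n.+1%:R t) Kn.
have cKs s : continuous (fun t => K (s, t)).
  apply: continuous_comp2 cK; apply: continuous_pair => t; first exact: cvg_cst.
  exact: cvg_id.
have move_good s s' : (forall t, arc (K (s', t) - K (s, t))) -> good s -> good s'.
  move=> sarc [k [ck kE kS]].
  exists (fun t => k t + arc_lift (K (s', t) - K (s, t))); split=> [|t|t].
  - have ce : continuous (fun t => K (s', t) - K (s, t)).
      apply: (@continuous_comp2 _ _ _ (fun t => (K (s', t), K (s, t))) _ _ continuous_subT1).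
      exact: continuous_pair.
    by move=> t; apply: cvgD; [exact: ck|exact: (continuous_arc_lift ce sarc)].
  - by rewrite piT1D kE (arc_liftP (sarc t)).2 addrC subrK.
  - by rewrite !K1 kS addrAC.
have tube s : \forall s' \near s, forall t, arc (K (s', t) - K (s, t)).
  have /compact_near_coveringP cov : compact `[0 : R, 1]%classic by exact: segment_compact.
  have := cov R (nbhs s) (fun s' t => arc (K (s', t) - K (s, t))) _ _.
  have h t : `[0 : R, 1]%classic t ->
      \forall t' \near t & s' \near s, arc (K (s', t') - K (s, t')).
    move=> _.
    have cM : continuous (fun z : R * R => K (z.2, z.1) - K (s, z.1)).
      apply: (@continuous_comp2 _ _ _ (fun z : R * R => (K (z.2, z.1), K (s, z.1)))
        _ _ continuous_subT1).
      apply: continuous_pair; apply: continuous_comp2 cK; apply: continuous_pair => z.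
      - exact: cvg_snd.
      - exact: cvg_fst.
      - exact: cvg_cst.
      - exact: cvg_fst.
    apply: (cM (t, s) arc); apply: open_nbhs_nbhs; split; first exact: open_arc.
    by exists 0 => /=; rewrite ?normr0// subrr piT1_0.
  move=> /(_ _ h); apply: filterS => s' h' t.
  have [t' t'01 tt'] := int_to_unit t.
  have := h' t'; rewrite /= in_itv/= t'01 => /(_ isT).
  by rewrite -(Kint s _ _ tt') -(Kint s' _ _ tt') [t' + _]addrC subrK.
pose chi s : R := (asbool (good s))%:R.
have cchi : continuous chi.
  move=> s; apply/cvgrPdist_lt => e e0; apply: filterS (tube s) => s' h.
  rewrite /chi (_ : `[< good s >] = `[< good s' >]) ?subrr ?normr0//.
  apply: asbool_equiv_eq; split; apply: move_good => // t.
  by rewrite -opprB; apply: arcN.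
have chi01 := int_valued_const cchi (fun s => natr_int R _) s0 s1.
have : good s1.
  move: chi01; rewrite /chi (asboolT (P := good s0)); last by exists k0.
  by case: asboolP => // _ /eqP; rewrite oner_eq0.
move=> [k [ck kE kS]] t.
have cz : continuous (fun t => k1 t - k t).
  by move=> u; apply: cvgB; [exact: ck1|exact: ck].
have kz u : k1 u - k u \is a Num.int by apply/piT1_eqP; rewrite k1E kE.
have := int_valued_const cz kz (t + 1) t; rewrite kS; lra.
Qed.

Lemma continuous_within_comp (S T U : topologicalType) (A : set T) (f : S -> T)
    (g : T -> U) : {within A, continuous g} -> continuous f ->
  (forall x, A (f x)) -> continuous (fun x => g (f x)).
Proof.
move=> /subspace_continuousP cg cf fA x B gB.
have := cf x _ (cg (f x) (fA x) B gB).
by apply: (@filterS _ (nbhs x)) => y /=; apply.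
Qed.

Lemma continuous_clamp : continuous (fun s : R => Num.max 0 (Num.min 1 s)).
Proof.
move=> s; apply: continuous_max; first exact: cvg_cst.
by apply: continuous_min; [exact: cvg_cst|exact: cvg_id].
Qed.

End Torus.

(** * Lifts of f to the plane *)

Section Shift.
Variables (R : realType) (f : T2 R -> T2 R) (l : int) (F : R * R -> R * R).
Hypothesis f_dehn : homotopic R f (@dehn_twist R l).
Hypothesis F_lift : plane_lift f F.

Let T (z : R * R) : R * R := (z.1 + z.2 * l%:~R, z.2).

Let piT2_T z : piT2 (T z) = dehn_twist l (piT2 z).
Proof. by rewrite /piT2 /T /dehn_twist /= piT1D mulrzr piT1Mz. Qed.

(** Applied to either axis as the loop [c] and to either coordinate [pr]: the four degrees are read
    off the explicit lift [T] of the Dehn twist. *)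
Let lift_degree (pr : T2 R -> T1 R) (prR : R * R -> R) (c : R -> R * R) (d : R) :
  continuous pr -> continuous prR -> (forall z, pr (piT2 z) = piT1 (prR z)) ->
  continuous c -> (forall t, piT2 (c (t + 1)) = piT2 (c t)) ->
  (forall t, prR (T (c (t + 1))) = prR (T (c t)) + d) ->
  forall t, prR (F (c (t + 1))) = prR (F (c t)) + d.
Proof.
move=> cpr cprR prE cc c1 Tc; have [Hm [cHm H0 H1]] := f_dehn.
have [cF FE] := F_lift.
(* Clamping the time extends the homotopy continuously from the unit interval to the whole line. *)
pose K (st : R * R) := pr (Hm (Num.max 0 (Num.min 1 st.1), piT2 (c st.2))).
have cK : continuous K.
  apply: continuous_comp2 cpr.
  apply: (continuous_within_comp cHm (f := fun st : R * R =>
    (Num.max 0 (Num.min 1 st.1), piT2 (c st.2)))) => [|st].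
    have cpc : continuous (fun t => piT2 (c t)).
      by move=> t; apply: (@continuous_comp _ _ _ c (@piT2 R)); [exact: cc|exact: continuous_piT2].
    exact: continuous_prod (@continuous_clamp R) cpc.
  split => //=; rewrite in_itv/= le_max lexx/= ge_max ler01/=.
  by rewrite ge_min lexx.
have cT : continuous T.
  apply: continuous_pair => z; last exact: cvg_snd.
  by apply: cvgD; [exact: cvg_fst|apply: cvgM; [exact: cvg_snd|exact: cvg_cst]].
apply: (degree_homotopy cK (s0 := 1) (s1 := 0) (k0 := fun t => prR (T (c t)))).
- by move=> s t; rewrite /K/= c1.
- exact: continuous_comp2 (continuous_comp2 cc cT) cprR.
- by move=> t; rewrite -prE piT2_T /K/= minxx max_r ?ler01// H1.
- exact: continuous_comp2 (continuous_comp2 cc cF) cprR.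
- by move=> t; rewrite -prE FE /K/= min_r ?ler01// maxxx H0.
- exact: Tc.
Qed.

Lemma lift_int z w : piT2 z = piT2 w -> (F z).1 - (F w).1 \is a Num.int /\
  (F z).2 - (F w).2 \is a Num.int.
Proof.
move=> zw; have [_ FE] := F_lift.
have : piT2 (F z) = piT2 (F w) by rewrite !FE zw.
by move=> [/piT1_eqP ? /piT1_eqP ?].
Qed.

Lemma lift_shift_const a b : a \is a Num.int -> b \is a Num.int ->
  forall x y x' y', (F (x + a, y + b)).1 - (F (x, y)).1 =
    (F (x' + a, y' + b)).1 - (F (x', y')).1 /\
    (F (x + a, y + b)).2 - (F (x, y)).2 =
    (F (x' + a, y' + b)).2 - (F (x', y')).2.
Proof.
move=> az bz x y x' y'; have [cF _] := F_lift.
have pz z : piT2 (z.1 + a, z.2 + b) = piT2 z by rewrite /piT2/= !piT1_int.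
have ca : continuous (fun z : R * R => F (z.1 + a, z.2 + b)).
  apply: continuous_comp2 cF; apply: continuous_pair => z.
    by apply: cvgD; [exact: cvg_fst|exact: cvg_cst].
  by apply: cvgD; [exact: cvg_snd|exact: cvg_cst].
split.
  have c1 : continuous (fun z : R * R => (F (z.1 + a, z.2 + b)).1 - (F z).1).
    by move=> z; apply: cvgB; [exact: continuous_fst_comp ca z|exact: continuous_fst_comp cF z].
  exact: int_valued_const2 c1 (fun z => (lift_int (pz z)).1) (x, y) (x', y').
have c2 : continuous (fun z : R * R => (F (z.1 + a, z.2 + b)).2 - (F z).2).
  by move=> z; apply: cvgB; [exact: continuous_snd_comp ca z|exact: continuous_snd_comp cF z].
exact: int_valued_const2 c2 (fun z => (lift_int (pz z)).2) (x, y) (x', y').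
Qed.

Let ch : continuous (fun t : R => (t, 0 : R)).
Proof. by apply: continuous_pair => t; [exact: cvg_id|exact: cvg_cst]. Qed.

Let cv : continuous (fun t : R => (0 : R, t)).
Proof. by apply: continuous_pair => t; [exact: cvg_cst|exact: cvg_id]. Qed.

Let cst (U V : topologicalType) : continuous (@fst U V).
Proof. by move=> z; exact: cvg_fst. Qed.

Let csnd (U V : topologicalType) : continuous (@snd U V).
Proof. by move=> z; exact: cvg_snd. Qed.

Lemma lift_x1 x y : F (x + 1, y) = ((F (x, y)).1 + 1, (F (x, y)).2).
Proof.
have h1 t : piT2 (t + 1, 0 : R) = piT2 (t, 0) by rewrite /piT2/= piT1_int ?int_num1.
have d1 := lift_degree (@cst _ _) (@cst _ _) (fun=> erefl) ch h1 (d := 1).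
have d2 := lift_degree (@csnd _ _) (@csnd _ _) (fun=> erefl) ch h1 (d := 0).
have := lift_shift_const (int_num1 R) (int_num0 R) x y 0 0.
rewrite !addr0 d1 ?d2 /T/= => [|t|t]; rewrite ?mul0r ?addr0//.
move=> [e1 e2].
by rewrite [LHS]surjective_pairing; congr pair; lra.
Qed.

Lemma lift_y1 x y : F (x, y + 1) = ((F (x, y)).1 + l%:~R, (F (x, y)).2 + 1).
Proof.
have h1 t : piT2 (0 : R, t + 1) = piT2 (0, t) by rewrite /piT2/= piT1_int ?int_num1.
have d1 := lift_degree (@cst _ _) (@cst _ _) (fun=> erefl) cv h1 (d := l%:~R).
have d2 := lift_degree (@csnd _ _) (@csnd _ _) (fun=> erefl) cv h1 (d := 1).
have := lift_shift_const (int_num0 R) (int_num1 R) x y 0 0.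
rewrite !addr0 d1 ?d2 /T/= => [|t|t]; rewrite ?mulrDl ?mul1r ?addrA//.
move=> [e1 e2].
by rewrite [LHS]surjective_pairing; congr pair; lra.
Qed.
End Shift.

(** * Lipschitz and displacement estimates for lifts *)

Lemma line_derive (R : realType) (F : R * R -> R * R) (pr : R * R -> R)
    (c : R -> R * R) (v : R * R) t :
  continuous pr ->
  (forall a (u w : R * R), pr (a *: (u - w)) = a * (pr u - pr w)) ->
  (forall h t, c (h + t) = h *: v + c t) -> differentiable F (c t) ->
  is_derive t 1 (fun t => pr (F (c t))) (pr ('D_v F (c t))).
Proof.
move=> cpr lpr cE dF; have := diff_derivable (v := v) dF.
rewrite /derivable => /cvg_ex [d dE].
have -> : 'D_v F (c t) = d by apply/cvg_lim.
have : pr (h^-1 *: ((F \o shift (c t)) (h *: v) - F (c t))) @[h --> 0^'] --> pr d.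
  by apply: (cvg_comp _ _ dE); exact: cpr.
rewrite (_ : (fun h => _) = fun h =>
    h^-1 *: (((fun t => pr (F (c t))) \o shift t) (h *: 1) - pr (F (c t)))).
  by move=> gd; apply: DeriveDef; [apply/cvg_ex; exists (pr d)|exact/cvg_lim].
by apply/funext => h; rewrite lpr /= cE /GRing.scale/= mulr1.
Qed.

Lemma periodic_bounded (R : realType) (g : R * R -> R) : continuous g ->
  (forall x y, g (x + 1, y) = g (x, y)) -> (forall x y, g (x, y + 1) = g (x, y)) ->
  exists2 B, 0 <= B & forall z, `|g z| <= B.
Proof.
move=> cg g1 g2.
have cI : compact (`[0 : R, 1]%classic `*` `[0 : R, 1]%classic).
  by apply: compact_setX; exact: segment_compact.
have cgI : compact (g @` (`[0 : R, 1]%classic `*` `[0 : R, 1]%classic)).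
  by apply: continuous_compact cI; apply: continuous_subspaceT.
have [M [_ HM]] := compact_bounded cgI.
have HM1 z : (`[0 : R, 1]%classic `*` `[0 : R, 1]%classic) z -> `|g z| <= `|M| + 1.
  by move=> zI; apply: HM; [have := ler_norm M; lra|exists z].
exists (`|M| + 1) => [|[x y]]; first by rewrite addr_ge0.
have [x' x'01 xx'] := int_to_unit x; have [y' y'01 yy'] := int_to_unit y.
have gx y0 : g (x, y0) = g (x', y0).
  rewrite -[x](subrK x') addrC.
  by rewrite (shift_int (f := fun x => g (x, y0)) (c := 0))// => *; rewrite ?g1 ?mulr0 addr0.
have gy : g (x', y) = g (x', y').
  rewrite -[y](subrK y') addrC.
  by rewrite (shift_int (f := fun y => g (x', y)) (c := 0))// => *; rewrite ?g2 ?mulr0 addr0.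
by rewrite gx gy; apply: HM1; split; rewrite /= in_itv.
Qed.

Lemma derive_shift (R : realType) (F : R * R -> R * R) (w c v z : R * R) :
  (forall u, F (u + w) = F u + c) -> 'D_v F (z + w) = 'D_v F z.
Proof.
move=> Fw; rewrite /derive.
rewrite (_ : (fun h => h^-1 *: ((F \o shift (z + w)) (h *: v) - F (z + w))) =
  (fun h => h^-1 *: ((F \o shift z) (h *: v) - F z)))//.
by apply/funext => h; rewrite /= addrA !Fw opprD addrACA subrr addr0.
Qed.

Lemma mean_value (R : realType) (g dg : R -> R) a b :
  (forall t, is_derive t (1 : R) g (dg t)) -> a <= b ->
  exists c, g b - g a = dg c * (b - a).
Proof.
move=> gd ab; have [|c _ cE] := @MVT_segment R g dg a b ab (fun x _ => gd x); last by exists c.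
- by apply: derivable_within_continuous => x _; case: (gd x).
Qed.

Lemma deriv_lipschitz (R : realType) (g dg : R -> R) B a b :
  (forall t, is_derive t (1 : R) g (dg t)) -> (forall t, `|dg t| <= B) ->
  `|g a - g b| <= B * `|a - b|.
Proof.
move=> gd dgB; wlog ab : a b / a <= b.
  move=> h; case: (leP a b) => [|/ltW] /h//.
  by rewrite distrC (distrC b).
have [c cE] := mean_value gd ab.
by rewrite distrC cE normrM (distrC a) ler_wpM2r.
Qed.

Section Estimates.
Variables (R : realType) (l k : R) (F : R * R -> R * R).
Hypothesis F_C1 : C1_plane F.
Hypothesis F_x1 : forall x y, F (x + 1, y) = ((F (x, y)).1 + 1, (F (x, y)).2).
Hypothesis F_y1 : forall x y, F (x, y + 1) = ((F (x, y)).1 + l, (F (x, y)).2 + 1).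

Let derivative_bounded v (pr : R * R -> R) : continuous pr ->
  exists2 B, 0 <= B & forall z, `|pr ('D_v F z)| <= B.
Proof.
move=> cpr; apply: periodic_bounded.
- exact: continuous_comp2 (F_C1.2 v) cpr.
- move=> x y; have -> : (x + 1, y) = (x, y) + (1, 0) :> R * R.
    by congr pair; rewrite addr0.
  rewrite (derive_shift (c := (1, 0)))// => -[u1 u2].
  rewrite (_ : _ + _ = (u1 + 1, u2)) ?F_x1; last by congr pair; rewrite addr0.
  by rewrite [in RHS](surjective_pairing (F (u1, u2))); congr pair; rewrite addr0.
- move=> x y; have -> : (x, y + 1) = (x, y) + (0, 1) :> R * R.
    by congr pair; rewrite addr0.
  rewrite (derive_shift (c := (l, 1)))// => -[u1 u2].
  rewrite (_ : _ + _ = (u1, u2 + 1)) ?F_y1; last by congr pair; rewrite addr0.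
  by rewrite [in RHS](surjective_pairing (F (u1, u2))).
Qed.

Let cfst : continuous (@fst R R). Proof. by move=> z; exact: cvg_fst. Qed.
Let csnd : continuous (@snd R R). Proof. by move=> z; exact: cvg_snd. Qed.

Let derive_x y t :
  is_derive t (1 : R) (fun t => (F (t, y)).1) ('D_(1, 0) F (t, y)).1.
Proof.
apply: (line_derive (c := fun t => (t, y))) => //; last exact: F_C1.1.
move=> h {}t; change ((h + t, y) = (h * 1 + t, h * 0 + y)).
by rewrite mulr1 mulr0 add0r.
Qed.

Let derive_y (pr : R * R -> R) x t : continuous pr ->
  (forall a (u w : R * R), pr (a *: (u - w)) = a * (pr u - pr w)) ->
  is_derive t (1 : R) (fun t => pr (F (x, t))) (pr ('D_(0, 1) F (x, t))).
Proof.
move=> cpr lpr; apply: (line_derive (c := fun t => (x, t))) => //; last exact: F_C1.1.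
move=> h {}t; change ((x, h + t) = (h * 0 + x, h * 1 + t)).
by rewrite mulr1 mulr0 add0r.
Qed.

Lemma lift_lipx : exists2 L, 0 <= L & forall x1 x2 y,
  `|(F (x1, y)).1 - (F (x2, y)).1| <= L * `|x1 - x2|.
Proof.
have [B B0 HB] := derivative_bounded (1, 0) cfst.
exists B => // x1 x2 y.
exact: (deriv_lipschitz _ _ (derive_x y) (fun t => HB _)).
Qed.

Lemma lift_lipy : exists2 L, 0 <= L & forall x y1 y2,
  `|(F (x, y1)).2 - (F (x, y2)).2| <= L * `|y1 - y2|.
Proof.
have [B B0 HB] := derivative_bounded (0, 1) csnd.
exists B => // x y1 y2.
by apply: (deriv_lipschitz _ _ (fun t => derive_y x t csnd _) (fun t => HB _)).
Qed.

Lemma lift_twist e : (forall x y, k < e * derive1 (fun t => (F (x, t)).1) y) ->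
  forall x y1 y2, y1 <= y2 ->
    k * (y2 - y1) <= e * ((F (x, y2)).1 - (F (x, y1)).1).
Proof.
move=> tw x y1 y2 y12.
have d t : is_derive t (1 : R) (fun t => (F (x, t)).1) ('D_(0, 1) F (x, t)).1.
  exact: derive_y.
have [c ->] := mean_value d y12.
have := tw x c; rewrite derive1E (@derive_val _ _ _ _ _ _ _ (d c)) => /ltW kc.
by rewrite mulrA ler_wpM2r// subr_ge0.
Qed.

Lemma lift_displacement : continuous F -> exists2 C, 0 <= C & forall x y,
  `|(F (x, y)).1 - x - l * y| <= C /\ `|(F (x, y)).2 - y| <= C.
Proof.
move=> cF.
have [|||C1 C10 H1] := @periodic_bounded R (fun z => (F z).1 - z.1 - l * z.2).
- move=> z; apply: cvgB; last by apply: cvgM; [exact: cvg_cst|exact: csnd].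
  by apply: cvgB; [exact: continuous_fst_comp cF z|exact: cfst].
- by move=> x y; rewrite F_x1/=; ring.
- by move=> x y; rewrite F_y1/=; ring.
have [|||C2 C20 H2] := @periodic_bounded R (fun z => (F z).2 - z.2).
- by move=> z; apply: cvgB; [exact: continuous_snd_comp cF z|exact: csnd].
- by move=> x y; rewrite F_x1/=; ring.
- by move=> x y; rewrite F_y1/=; ring.
exists (C1 + C2) => [|x y]; first exact: addr_ge0.
by split; [apply: le_trans (H1 (x, y)) _|apply: le_trans (H2 (x, y)) _]; lra.
Qed.

End Estimates.

(** A composite of lifts of [f] and [g] lifts the identity, hence is a deck translation. Correcting
    [G0] by one makes it a right inverse of [F]; the other composite is then shown to be trivial. *)
Lemma lift_inverse (R : realType) (f g : T2 R -> T2 R) (l : int)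
    (F G0 : R * R -> R * R) :
  cancel f g -> cancel g f -> plane_lift f F -> plane_lift g G0 ->
  (forall x y, F (x + 1, y) = ((F (x, y)).1 + 1, (F (x, y)).2)) ->
  (forall x y, F (x, y + 1) = ((F (x, y)).1 + l%:~R, (F (x, y)).2 + 1)) ->
  exists G, [/\ continuous G, cancel F G & cancel G F].
Proof.
move=> fK gK [cF FE] [cG GE] F_x1 F_y1.
have Fa x y a : a \is a Num.int -> F (x + a, y) = ((F (x, y)).1 + a, (F (x, y)).2).
  move=> az; rewrite [LHS]surjective_pairing.
  rewrite (shift_int (f := fun x => (F (x, y)).1) (c := 1))// => [|x']; last by rewrite F_x1.
  rewrite (shift_int (f := fun x => (F (x, y)).2) (c := 0))// => [|x']; last by rewrite F_x1 addr0.
  by rewrite mulr1 mulr0 addr0.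
have Fb x y b : b \is a Num.int ->
    F (x, y + b) = ((F (x, y)).1 + b * l%:~R, (F (x, y)).2 + b).
  move=> az; rewrite [LHS]surjective_pairing.
  rewrite (shift_int (f := fun y => (F (x, y)).1) (c := l%:~R))// => [|x']; last by rewrite F_y1.
  rewrite (shift_int (f := fun y => (F (x, y)).2) (c := 1))// => [|x']; last by rewrite F_y1.
  by rewrite mulr1.
have translation (h : R * R -> R * R) : continuous h ->
    (forall z, piT2 (h z) = piT2 z) -> exists a b,
    [/\ a \is a Num.int, b \is a Num.int & forall z, h z = (z.1 + a, z.2 + b)].
  move=> ch hE.
  have hz z : (h z).1 - z.1 \is a Num.int /\ (h z).2 - z.2 \is a Num.int.
    by have [/piT1_eqP ? /piT1_eqP ?] := hE z.
  have c1 : continuous (fun z => (h z).1 - z.1).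
    by move=> z; apply: cvgB; [exact: continuous_fst_comp ch z|exact: cvg_fst].
  have c2 : continuous (fun z => (h z).2 - z.2).
    by move=> z; apply: cvgB; [exact: continuous_snd_comp ch z|exact: cvg_snd].
  pose o : R * R := (0, 0); exists ((h o).1 - o.1), ((h o).2 - o.2).
  split; [exact: (hz _).1|exact: (hz _).2|move=> z].
  rewrite (int_valued_const2 c1 (fun z => (hz z).1) o z).
  rewrite (int_valued_const2 c2 (fun z => (hz z).2) o z).
  by rewrite addrC subrK addrC subrK -surjective_pairing.
have [|z|a [b [az bz FG]]] := translation (fun z => F (G0 z)).
- exact: continuous_comp2 cG cF.
- by rewrite FE GE gK.
pose G (z : R * R) := G0 (z.1 - a, z.2 - b).
have cGG : continuous G.
  apply: continuous_comp2 cG; apply: continuous_pair => z.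
    by apply: cvgB; [exact: cvg_fst|exact: cvg_cst].
  by apply: cvgB; [exact: cvg_snd|exact: cvg_cst].
have GK : cancel G F by move=> z; rewrite FG/= !subrK -surjective_pairing.
exists G; split => //.
have [|z|a' [b' [az' bz' GF]]] := translation (fun z => G (F z)).
- exact: continuous_comp2 cF cGG.
- have Fab : piT2 ((F z).1 - a, (F z).2 - b) = piT2 (F z).
    by rewrite /piT2/= !piT1_int ?rpredN.
  by rewrite /G GE Fab FE fK.
(* Apply [F] to the translation [G \o F]: since [F \o G] is the identity, the translation acts
   trivially after [F], which determines [b'] and then [a']. *)
have shift0 z : F z = ((F z).1 + b' * l%:~R + a', (F z).2 + b').
  rewrite -{1}(GK (F z)) GF [z in RHS]surjective_pairing.
  by rewrite Fa// Fb.
have b0 : b' = 0.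
  have /(congr1 snd) /= := shift0 0; lra.
have a0 : a' = 0.
  have /(congr1 fst) /= := shift0 0; rewrite b0; lra.
by move=> z; rewrite GF a0 b0 !addr0 -surjective_pairing.
Qed.

Lemma open_plane_measurable (R : realType) (O : set (R * R)) : open O ->
  measurable (O : set (measurableTypeR R * measurableTypeR R)).
Proof.
move=> Oo; pose rect (q : (rat * rat) * (rat * rat)) : set (R * R) :=
  `]ratr q.1.1, ratr q.1.2[%classic `*` `]ratr q.2.1, ratr q.2.2[%classic.
pose A n : set (R * R) := if unpickle n is Some q then
  (if `[< rect q `<=` O >] then rect q else set0) else set0.
have -> : O = \bigcup_n A n.
  apply/seteqP; split=> [[x y] Oxy|z [n _]].
    have [e e0 eO] := open_square Oo Oxy.
    have lt1 r : r - e < r :> R by lra.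
    have lt2 r : r < r + e :> R by lra.
    have [q1] := rat_in_itvoo (lt1 x); have [q2] := rat_in_itvoo (lt2 x).
    have [q3] := rat_in_itvoo (lt1 y); have [q4] := rat_in_itvoo (lt2 y).
    rewrite !in_itv/= => /andP[d1 d2] /andP[c1 c2] /andP[b1 b2] /andP[a1 a2].
    exists (pickle ((q1, q2), (q3, q4))); first exact: I.
    rewrite /A pickleK asboolT; first by split; rewrite /= in_itv/=; apply/andP.
    move=> [u v] [] /=; rewrite !in_itv/= => /andP[u1 u2] /andP[v1 v2].
    by apply: eO; rewrite ltr_norml; apply/andP; split; lra.
  by rewrite /A; case: unpickle => // q; case: asboolP => // qO /qO.
apply: bigcupT_measurable => n; rewrite /A; case: unpickle => // q.
by case: ifP => // _; apply: measurableX; exact: measurable_itv.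
Qed.

(** * Poincare recurrence on the torus *)

Section Recurrence.
Variables (R : realType) (f : T2 R -> T2 R).
Hypothesis cf : continuous f.
Hypothesis f_area : area_preserving f.

Notation mu := (@lebesgue_measure R \x @lebesgue_measure R)%E.
Let Q : set (R * R) := `[0, 1[%classic `*` `[0, 1[%classic.

Let mQ : measurable (Q : set (measurableTypeR R * measurableTypeR R)).
Proof. by apply: measurableX; exact: measurable_itv. Qed.

Let mT (O : set (T2 R)) : open O ->
  measurable (Q `&` @piT2 R @^-1` O : set (measurableTypeR R * measurableTypeR R)).
Proof.
move=> Oo; apply: measurableI => //; apply: open_plane_measurable.
by apply: open_comp => // z _; exact: continuous_piT2.
Qed.

Let square_measure (a b e : R) : 0 < e ->
  mu (`[a, a + e[%classic `*` `[b, b + e[%classic) = (e * e)%:E.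
Proof.
move=> e0; have h (c : R) : lebesgue_measure `[c, c + e[%classic = e%:E.
  by rewrite lebesgue_measure_itv/= lte_fin ltrDl e0 -EFinD addrAC subrr add0r.
rewrite product_measure1E; try exact: measurable_itv.
by rewrite EFinM; congr (_ * _)%E; exact: h.
Qed.

Let muQ : mu Q = 1%:E.
Proof. by have := square_measure 0 0 ltr01; rewrite add0r mulr1. Qed.

Let mu_open_gt0 (O : set (T2 R)) : open O -> O !=set0 ->
  exists2 r : R, 0 < r & (r%:E <= lebesgueT2 O)%E.
Proof.
move=> Oo [p Op]; have [[x y] xyp] := piT2_surj p.
have unit_rep (t : R) : exists2 t', 0 <= t' < 1 & piT1 t' = piT1 t.
  have [a az /andP[a1 a2]] := ceil_bounds (- t).
  by exists (t + a); [apply/andP; split; lra|rewrite piT1_int].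
have [x' /andP[x0 x1] xE] := unit_rep x; have [y' /andP[y0 y1] yE] := unit_rep y.
have Oo' : open (@piT2 R @^-1` O).
  by apply: open_comp => // z _; exact: continuous_piT2.
have Oxy : (@piT2 R @^-1` O) (x', y') by rewrite /= /piT2/= xE yE -xyp in Op *.
have [e e0 eO] := open_square Oo' Oxy.
(* Keeps the square inside the fundamental domain, where [lebesgueT2] is computed. *)
pose d := Num.min e (Num.min (1 - x') (1 - y')).
have d0 : 0 < d by rewrite !lt_min e0 !subr_gt0 x1.
have [d1 d2 d3] : [/\ d <= e, d <= 1 - x' & d <= 1 - y'].
  by rewrite !ge_min !lexx !orbT.
exists (d * d); first exact: mulr_gt0.
rewrite -(square_measure x' y' d0); apply: le_measure; rewrite ?inE.
- by apply: measurableX; exact: measurable_itv.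
- exact: mT.
- move=> [u v] [] /=; rewrite !in_itv/= => /andP[u1 u2] /andP[v1 v2]; split.
    rewrite /Q; split; rewrite /= ?in_itv/=; apply/andP; split; lra.
  by apply: eO; rewrite ltr_norml; apply/andP; split; lra.
Qed.

(** Otherwise the preimages of [O] under the iterates would be pairwise disjoint, of equal positive
    measure, in a square of measure 1. *)
Lemma torus_recurrence (O : set (T2 R)) : open O -> O !=set0 ->
  exists i p, [/\ (0 < i)%N, O p & O (iter i f p)].
Proof.
move=> Oo O0; apply: contrapT => norec.
pose A i := iter i f @^-1` O.
have Ao i : open (A i).
  by apply: open_comp => // p _; exact: continuous_iter.
have AE i : lebesgueT2 (A i) = lebesgueT2 O.
  elim: i => // i <-.
  have Ab : <<s [set U : set (T2 R) | open U] >> (A i).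
    by apply: sub_sigma_algebra; exact: Ao.
  rewrite -(f_area Ab).
  by congr lebesgueT2; apply/funext => p; rewrite /A /preimage/= -iterS iterSr.
have Alt i j p : (i < j)%N -> A i p -> A j p -> False.
  move=> ij Ai Aj; apply: norec; exists (j - i)%N, (iter i f p).
  by rewrite subn_gt0 ij -iterD subnK// ltnW.
pose B i := Q `&` @piT2 R @^-1` A i.
have tB : trivIset setT B.
  apply/trivIsetP => i j _ _ ij; apply/seteqP; split => // z [[_ Ai] [_ Aj]].
  move: ij; rewrite neq_ltn => /orP[ij|ij].
    exact: Alt ij Ai Aj.
  exact: Alt ij Aj Ai.
have mB i : measurable (B i : set (measurableTypeR R * measurableTypeR R)) by exact: mT.
have [r r0 rO] := mu_open_gt0 Oo O0.
apply: (ltr_archi_absurd (b := 1) r0) => n.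
have : (mu (\big[setU/set0]_(i < n) B i) <= mu Q)%E.
  apply: le_measure; rewrite ?inE//.
    by apply: bigsetU_measurable => i _.
  by rewrite -(bigcup_mkord n B) => z [i _ []].
rewrite muQ measure_bigsetU// -lee_fin; apply: le_trans.
have -> : (n%:R * r)%:E = (\sum_(i < n) r%:E)%E.
  by rewrite sumEFin sumr_const card_ord mulr_natl.
by apply: lee_sum => i _; rewrite (le_trans rO)// -(AE i).
Qed.

Lemma recurrent_lift F : plane_lift f F -> recurrent F.
Proof.
move=> [cF FE] B Bo [z Bz].
have FEn n w : piT2 (iter n F w) = iter n f (piT2 w).
  by elim: n => //= n <-; rewrite FE.
have [|i [_ [i0 [w Bw <-] [w' Bw']]]] := torus_recurrence (open_piT2 Bo).
  by exists (piT2 z), z.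
rewrite -FEn => /piT2_eqP[a [b [az bz w'E]]].
by exists i, w, a, b; rewrite -w'E.
Qed.
End Recurrence.

(** Compactness: slopes lie between [- C] and [C], so slopes over longer and longer times that stay
    away from [alpha] would have a cluster point in [rhoV fhat] other than [alpha]. Short times go
    into the constant. *)
Lemma rotation_of_rhoV (R : realType) (fhat : T1 R * R -> T1 R * R)
    (F : R * R -> R * R) (alpha C : R) :
  (forall z, fhat (piT1 z.1, z.2) = (piT1 (F z).1, (F z).2)) ->
  (forall x y, `|(F (x, y)).2 - y| <= C) -> rhoV fhat = [set alpha] ->
  rotation F alpha.
Proof.
move=> fF FC rho.
have fFn n z : iter n fhat (piT1 z.1, z.2) = (piT1 (iter n F z).1, (iter n F z).2).
  by elim: n => //= n ->; rewrite fF.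
have drift n z : `|(iter n F z).2 - z.2| <= C * n%:R.
  elim: n => [|n IH]; first by rewrite subrr normr0 mulr0.
  have := FC (iter n F z).1 (iter n F z).2; rewrite -surjective_pairing /=.
  by move: IH; rewrite -natr1 !ler_norml; lra.
pose d n z := ((iter n F z).2 - z.2) / n%:R.
have unif e : 0 < e -> exists N, forall n z, (N <= n)%N -> (0 < n)%N ->
    `|d n z - alpha| <= e.
  move=> e0; apply: contrapT => bad.
  have /choice[u uP] : forall N, exists r : R, [/\ `|r| <= C, e < `|r - alpha| &
      exists n z, (N <= n)%N /\ r = d n z].
    move=> N; apply: contrapT => noN; apply: bad; exists N => n z Nn n0.
    rewrite leNgt; apply/negP => dn; apply: noN; exists (d n z); split => //.
      rewrite /d normrM normfV (ger0_norm (ler0n _ _)).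
      by rewrite ler_pdivrMr ?ltr0n// drift.
    by exists n, z.
  have cC : compact `[- C, C]%classic by exact: segment_compact.
  have uC : (u @ \oo) `[- C, C]%classic.
    by exists 0%N => // N _; rewrite /= in_itv/= -ler_norml; case: (uP N).
  have [p [_ clp]] := cC (u @ \oo) _ uC.
  have : rhoV fhat p.
    move=> i /= i0 B pB; apply: clp pB; exists i => // N /= iN.
    have [_ _ [n [z [Nn ->]]]] := uP N.
    exists n; first exact: leq_trans iN Nn.
    by exists (piT1 z.1, z.2) => //; rewrite fFn.
  rewrite rho /= => pE.
  have : (u @ \oo) [set r | e < `|r - alpha|] by exists 0%N => // N _; case: (uP N).
  move=> /clp /(_ (nbhsx_ballx p e e0)) [r [/= er]].
  by rewrite pE /ball/= distrC; lra.
move=> e e0; have [N HN] := unif e e0.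
exists (N%:R * (C + `|alpha|)) => n z.
have C0 : 0 <= C by apply: le_trans (normr_ge0 _) (FC 0 0).
have [nN|nN] := leqP N n; last first.
  have h : n%:R * (C + `|alpha|) <= N%:R * (C + `|alpha|).
    by rewrite ler_wpM2r ?addr_ge0// ler_nat ltnW.
  have en : 0 <= e * n%:R by rewrite mulr_ge0// ltW.
  apply: le_trans (ler_normB _ _) _; rewrite normrM normr_nat.
  by have := drift n z; lra.
have [->|n0] := posnP n; first by rewrite /= subrr !mul0r subr0 normr0 mulr0 add0r
   mulr_ge0// addr_ge0.
have -> : (iter n F z).2 - z.2 - n%:R * alpha = (d n z - alpha) * n%:R.
  by rewrite mulrBl /d divfK ?pnatr_eq0 -?lt0n// [alpha * _]mulrC.
rewrite normrM normr_nat ler_wpDr ?mulr_ge0 ?addr_ge0//.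
by rewrite ler_wpM2r ?HN.
Qed.

(** By the twist, two points of one vertical with images on one vertical coincide; so the
    x-coordinate of [G] is injective along verticals, hence monotone by continuity. Its drop by [l]
    per unit of height fixes the direction. *)
Lemma inverse_decreasing (R : realType) (l k : R) (F G : R * R -> R * R) :
  0 < l -> l \is a Num.int -> 0 < k -> cancel F G -> cancel G F -> continuous G ->
  (forall x y, F (x + 1, y) = ((F (x, y)).1 + 1, (F (x, y)).2)) ->
  (forall x y, F (x, y + 1) = ((F (x, y)).1 + l, (F (x, y)).2 + 1)) ->
  (forall x y1 y2, y1 <= y2 -> k * (y2 - y1) <= (F (x, y2)).1 - (F (x, y1)).1) ->
  forall x y1 y2, y1 < y2 -> (G (x, y2)).1 < (G (x, y1)).1.
Proof.
move=> l0 lz k0 FK GK cG F_x1 F_y1 tw x y1 y2 y12.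
have Ginj a b : a < b -> (G (x, a)).1 = (G (x, b)).1 -> False.
  move=> ab Gab; have Fa := GK (x, a); have Fb := GK (x, b).
  have h u v : u < v -> (F ((G (x, a)).1, u)).1 = (F ((G (x, a)).1, v)).1 -> False.
    move=> uv Fuv; have := tw (G (x, a)).1 _ _ (ltW uv).
    by rewrite Fuv subrr; have : 0 < k * (v - u) by [rewrite mulr_gt0// subr_gt0]; lra.
  have F1a : (F ((G (x, a)).1, (G (x, a)).2)).1 = x by rewrite -surjective_pairing Fa.
  have F1b : (F ((G (x, a)).1, (G (x, b)).2)).1 = x by rewrite Gab -surjective_pairing Fb.
  have [lt2|lt2|eq2] := ltgtP (G (x, a)).2 (G (x, b)).2.
  - by apply: (h _ _ lt2); rewrite F1a.
  - by apply: (h _ _ lt2); rewrite F1a.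
  - have : G (x, a) = G (x, b).
      by rewrite [LHS]surjective_pairing [RHS]surjective_pairing Gab eq2.
    by move=> Gab'; move: Fb; rewrite -Gab' Fa => -[ba]; rewrite ba ltxx in ab.
have G1 y : (G (x, y + 1)).1 = (G (x, y)).1 - l.
  have -> : (x, y + 1) = F ((G (x, y)).1 - l, (G (x, y)).2 + 1); last by rewrite FK.
  rewrite F_y1 (shift_int (f := fun u => (F (u, (G (x, y)).2)).1) (c := 1));
    [|by move=> u; rewrite F_x1|by rewrite rpredN].
  rewrite (shift_int (f := fun u => (F (u, (G (x, y)).2)).2) (c := 0));
    [|by move=> u; rewrite F_x1 addr0|by rewrite rpredN].
  by rewrite -surjective_pairing GK/=; congr pair; ring.
rewrite ltNge; apply/negP; rewrite le_eqVlt => /orP[/eqP|lt12]; first exact: Ginj.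
pose h y := (G (x, y)).1.
have ch : continuous h.
  apply: continuous_fst_comp; apply: continuous_comp2 cG.
  by apply: continuous_pair => ?; [exact: cvg_cst|exact: cvg_id].
have hn (n : nat) : h (y2 + n%:R) = h y2 - n%:R * l.
  elim: n => [|n IH]; first by rewrite addr0 mul0r subr0.
  by rewrite -natr1 addrA [LHS]G1 -/(h _) IH; ring.
have [n nP] : exists n : nat, h y2 - h y1 < n%:R * l.
  apply: contrapT => nn; apply: (ltr_archi_absurd (b := h y2 - h y1) l0) => n.
  by rewrite leNgt; apply/negP => lt; apply: nn; exists n.
have y2n : y2 <= y2 + n%:R by rewrite lerDl.
have [||c] := @IVT R h y2 (y2 + n%:R) (h y1) y2n.
- by apply: continuous_subspaceT.
- rewrite hn ge_min le_max; apply/andP; split; apply/orP; [right|left].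
    by lra.
  exact: ltW.
rewrite in_itv/= => /andP[y2c _] hc.
exact: (Ginj y1 c (lt_le_trans y12 y2c)).
Qed.

(** * The height attached to the torus map *)

Section PlaneHeight.
Variables (R : realType) (f : T2 R -> T2 R) (fhat : T1 R * R -> T1 R * R).
Variable alpha : R.
Hypothesis f_tw : Diff1_tw f.
Hypothesis f_area : area_preserving f.
Hypothesis fhat_lift : cylinder_lift f fhat.
Hypothesis alpha_irr : irrational alpha.
Hypothesis rho_alpha : rhoV fhat = [set alpha].

Lemma irrational_mulrn n : (0 < n)%N -> n%:R * alpha \isn't a Num.int.
Proof.
move=> n0; apply/negP => /intrP[m mE]; apply: alpha_irr.
apply/rationalP; exists m, n; rewrite -mE mulrAC mulfV ?mul1r//.
by rewrite pnatr_eq0 -lt0n.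
Qed.

(** The rotation number depends on the lift, so a lift of [f] to the plane must be corrected by a
    vertical integer translation in order to cover [fhat]. *)
Lemma cylinder_plane_lift F0 : plane_lift f F0 -> exists2 m : R,
  m \is a Num.int &
  forall z, fhat (piT1 z.1, z.2) = (piT1 (F0 z).1, (F0 z).2 + m).
Proof.
move=> [cF FE]; have [cfh fhE] := fhat_lift.
have pE z : piC (fhat (piT1 z.1, z.2)) = piT2 (F0 z) by rewrite fhE FE.
have c2 : continuous (fun z : R * R => (fhat (piT1 z.1, z.2)).2 - (F0 z).2).
  have ch : continuous (fun z : R * R => fhat (piT1 z.1, z.2)).
    apply: (@continuous_comp2 _ _ _ (fun z : R * R => (piT1 z.1, z.2)) _ _ cfh).
    exact: continuous_prod (@continuous_piT1 R) (fun x => cvg_id).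
  by move=> z; apply: cvgB; [exact: continuous_snd_comp ch z|exact: continuous_snd_comp cF z].
have z2 z : (fhat (piT1 z.1, z.2)).2 - (F0 z).2 \is a Num.int.
  by apply/piT1_eqP; have [] := pE z.
exists ((fhat (piT1 (0 : R), 0)).2 - (F0 (0, 0)).2); first exact: (z2 (0, 0)).
move=> z; rewrite (int_valued_const2 c2 z2 (0, 0) z) addrC subrK.
by rewrite [LHS]surjective_pairing; congr pair; have [] := pE z.
Qed.

Lemma plane_height : exists F (H : R * R -> R) (K : R), [/\ plane_lift f F, 0 <= K, continuous H &
  [/\ forall x y a b, a \is a Num.int -> b \is a Num.int ->
        H (x + a, y + b) = H (x, y) + b,
      forall x y x' y', y + K * `|x' - x| <= y' -> H (x, y) <= H (x', y'),
      forall x y1 y2, y1 < y2 -> H (x, y1) < H (x, y2) &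
      forall z, H (F z) = H z + alpha]].
Proof.
have [[[F0 F0l F0C1] [g [fK gK [G0 G0l _]]]] [l [l0 hom [k k0 tw]]]] := f_tw.
have [m mz fhE] := cylinder_plane_lift F0l.
pose F (z : R * R) := ((F0 z).1, (F0 z).2 + m).
have cF : continuous F.
  apply: continuous_pair => z; first exact: continuous_fst_comp F0l.1 z.
  by apply: cvgD; [exact: continuous_snd_comp F0l.1 z|exact: cvg_cst].
have Fl : plane_lift f F.
  by split => // z; rewrite -F0l.2 /piT2/= piT1_int.
have F1E z : (F z).1 = (F0 z).1 by [].
have F2E z : (F z).2 = (F0 z).2 + m by [].
have {}fhE z : fhat (piT1 z.1, z.2) = (piT1 (F z).1, (F z).2) by exact: fhE.
clearbody F; have F_x1 := lift_x1 hom Fl; have F_y1 := lift_y1 hom Fl.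
have F0_x1 := lift_x1 hom F0l; have F0_y1 := lift_y1 hom F0l.
have [G [cG FK GK]] := lift_inverse fK gK Fl G0l F_x1 F_y1.
(* The sign of [l]: conjugating by the reflection of x when [e] is -1 makes the twist positive, and
   leaves heights and therefore the rotation unchanged. *)
pose e : R := l%:~R / `|l%:~R|.
have lR0 : l%:~R != 0 :> R by rewrite intr_eq0.
have ee : e * e = 1.
  by rewrite /e mulrACA -invfM -normrM ger0_norm ?mulfV ?mulf_neq0// -expr2 sqr_ge0.
have el : e * l%:~R = `|l%:~R|.
  rewrite /e mulrAC -expr2 -real_normK ?num_real// expr2 mulfK// normr_eq0//.
have el0 : 0 < e * l%:~R by rewrite el normr_gt0.
have elz : e * l%:~R \is a Num.int by rewrite el -intr_norm intr_int.
have ez : e \is a Num.int.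
  rewrite /e; case: (ltrgt0P (l%:~R : R)) => h; last by rewrite h eqxx in lR0.
    by rewrite divff// int_num1.
  by rewrite invrN mulrN divff// rpredN int_num1.
have en : `|e| = 1 by rewrite /e normrM normfV normr_id mulfV// normr_eq0.
have eeK x : e * (e * x) = x by rewrite mulrA ee mul1r.
pose s (z : R * R) := (e * z.1, z.2).
have sK : involutive s by move=> [x y]; rewrite /s/= eeK.
have cs : continuous s.
  apply: continuous_pair => z; last exact: cvg_snd.
  by apply: cvgM; [exact: cvg_cst|exact: cvg_fst].
pose Fe z := s (F (s z)); pose Ge z := s (G (s z)).
have cFe : continuous Fe.
  exact: continuous_comp2 (continuous_comp2 cs cF) cs.
have cGe : continuous Ge.
  exact: continuous_comp2 (continuous_comp2 cs cG) cs.
have [L1 L10 HL1] := lift_lipx F0C1 F0_x1 F0_y1.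
have [L2 L20 HL2] := lift_lipy F0C1 F0_x1 F0_y1.
have HT := lift_twist F0C1 (tw F0 F0l).
have [C C0 HC] := lift_displacement F_x1 F_y1 cF.
have FeE x y : Fe (x, y) = (e * (F (e * x, y)).1, (F (e * x, y)).2) by [].
have FeK : cancel Fe Ge by move=> z; rewrite /Fe /Ge sK FK sK.
have GeK : cancel Ge Fe by move=> z; rewrite /Fe /Ge sK GK sK.
have F_ex1 x y : F (x + e, y) = ((F (x, y)).1 + e, (F (x, y)).2).
  rewrite [LHS]surjective_pairing.
  rewrite (shift_int (f := fun u => (F (u, y)).1) (c := 1))//; last by move=> u; rewrite F_x1.
  rewrite (shift_int (f := fun u => (F (u, y)).2) (c := 0))//; last by move=> u; rewrite F_x1 addr0.
  by rewrite mulr1 mulr0 addr0.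
have Fe_x1 x y : Fe (x + 1, y) = ((Fe (x, y)).1 + 1, (Fe (x, y)).2).
  by rewrite !FeE/= mulrDr mulr1 F_ex1/= mulrDr ee.
have Fe_y1 x y : Fe (x, y + 1) = ((Fe (x, y)).1 + e * l%:~R, (Fe (x, y)).2 + 1).
  by rewrite !FeE/= F_y1/= mulrDr.
have Fe_tw x y1 y2 : y1 <= y2 -> k * (y2 - y1) <= (Fe (x, y2)).1 - (Fe (x, y1)).1.
  by move=> y12; rewrite !FeE/= -mulrBr !F1E; exact: HT.
have tl : twist_lift (e * l%:~R) k (L1 + L2) C Fe Ge.
  split => //.
  - exact: addr_ge0.
  - move=> x1 x2 y; rewrite !FeE/= -mulrBr normrM en mul1r !F1E.
    apply: le_trans (HL1 _ _ _) _; rewrite -mulrBr normrM en mul1r.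
    by rewrite ler_wpM2r// lerDl.
  - move=> x y1 y2; rewrite !FeE/= !F2E opprD addrACA subrr addr0.
    apply: le_trans (HL2 _ _ _) _.
    by rewrite ler_wpM2r// lerDr.
  - move=> x y; rewrite FeE/=; have [h _] := HC (e * x) y.
    have -> : e * (F (e * x, y)).1 - x - e * l%:~R * y =
        e * ((F (e * x, y)).1 - e * x - l%:~R * y) by rewrite !mulrBr eeK mulrA.
    by rewrite normrM en mul1r.
  - by move=> x y; rewrite FeE/=; have [_ h] := HC (e * x) y.
  - exact: inverse_decreasing el0 elz k0 FeK GeK cGe Fe_x1 Fe_y1 Fe_tw.
have sFe n z : iter n Fe z = s (iter n F (s z)).
  elim: n => [|n IH]; first by rewrite [RHS]sK.
  by rewrite !iterS IH /Fe sK.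
have rotF : rotation F alpha.
  exact: rotation_of_rhoV fhE (fun x y => (HC x y).2) rho_alpha.
have rotFe : rotation Fe alpha.
  move=> d d0; have [B HB] := rotF d d0; exists B => n z.
  by have := HB n (s z); rewrite sFe.
have cf : continuous f.
  apply: continuous_T2; rewrite (_ : (fun z => _) = fun z => piT2 (F z)).
    exact: continuous_comp2 cF (@continuous_piT2 R).
  by apply/funext => z; rewrite Fl.2.
have recFe : recurrent Fe.
  move=> B Bo [z Bz].
  have Bo' : open (s @^-1` B) by apply: open_comp => // ? _; exact: cs.
  have [|i [w [a [b [i0 Bw az bz Bw']]]]] := recurrent_lift cf f_area Fl Bo'.
    by exists (s z); rewrite /= sK.
  exists i, (s w), (e * a), b; split => //; first by rewrite rpredM.
  by move: Bw'; rewrite sFe sK /= /s/= mulrDr.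
pose H z := height Fe alpha (s z).
exists F, H, ((L1 + L2) / k); split => //.
- by rewrite divr_ge0 ?addr_ge0// ltW.
- exact: continuous_comp2 cs (continuous_height tl rotFe recFe irrational_mulrn).
split.
- move=> x y a b az bz; rewrite /H /s/= mulrDr.
  by apply: (height_shift tl rotFe) => //; rewrite rpredM.
- move=> x y x' y' h; apply: (height_lip tl rotFe recFe).
  by rewrite -mulrBr normrM en mul1r.
- move=> x y1 y2; exact: (height_incr tl rotFe recFe irrational_mulrn).
- by move=> z; rewrite /H -(height_eq tl rotFe recFe) /Fe sK.
Qed.
End PlaneHeight.

(** * The foliation by level curves *)

Lemma open_map_incr (R : realType) (h : R -> R) : continuous h ->
  (forall x y, x < y -> h x < h y) -> open_map h.
Proof.
move=> ch hincr V Vo; rewrite openE => _ [q Vq <-].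
have /nbhs_ballP[e /= e0 eV] := open_nbhs_nbhs (conj Vo Vq).
have e1 : q - e / 2 < q by lra.
have e2 : q < q + e / 2 by lra.
have : nbhs (h q) `]h (q - e / 2), h (q + e / 2)[%classic.
  by apply: near_in_itvoo; rewrite in_itv/= !hincr.
apply: filterS => r; rewrite /= in_itv/= => /andP[r1 r2].
have [||c] := @IVT R h (q - e / 2) (q + e / 2) r (ltW (lt_trans e1 e2)).
- by apply: continuous_subspaceT.
- by rewrite ge_min le_max (ltW r1) (ltW r2) orbT.
rewrite in_itv/= => /andP[c1 c2] <-; exists c => //; apply: eV.
by rewrite /ball/= ltr_norml; apply/andP; split; lra.
Qed.

(* An increasing homeomorphism of the line onto ]-1/4, 1/4[. *)
Definition squeeze (R : realType) (q : R) : R := q / (4 * (1 + `|q|)).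

Section Squeeze.
Variable R : realType.
Implicit Types p q : R.

Let den_gt0 q : 0 < 4 * (1 + `|q|).
Proof. by rewrite mulr_gt0// ltr_pwDl. Qed.

Lemma squeeze_lt q : `|squeeze q| < 1 / 4.
Proof.
rewrite /squeeze normrM normfV (gtr0_norm (den_gt0 q)) ltr_pdivrMr//; lra.
Qed.

Lemma squeeze_incr p q : p < q -> squeeze p < squeeze q.
Proof.
move=> pq; rewrite /squeeze ltr_pdivrMr// mulrAC ltr_pdivlMr//.
have [p0|p0] := ltP p 0; have [q0|q0] := ltP q 0.
- rewrite (ltr0_norm p0) (ltr0_norm q0); lra.
- rewrite (ltr0_norm p0) (ger0_norm q0).
  have : 0 <= (- p) * q by rewrite mulr_ge0// oppr_ge0 ltW.
  lra.
- lra.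
- rewrite (ger0_norm p0) (ger0_norm q0); lra.
Qed.

Lemma continuous_squeeze : continuous (@squeeze R).
Proof.
move=> q; apply: cvgM; first exact: cvg_id.
apply: cvgV; first by rewrite gt_eqF.
apply: cvgM; first exact: cvg_cst.
by apply: cvgD; [exact: cvg_cst|apply: cvg_norm; exact: cvg_id].
Qed.

Lemma squeeze_inj_int p q a : a \is a Num.int ->
  squeeze p = squeeze q + a -> p = q /\ a = 0.
Proof.
move=> /intrP[m ->] pqa; have m0 : m = 0.
  have := squeeze_lt p; have := squeeze_lt q.
  rewrite !ltr_norml => /andP[a1 a2] /andP[b1 b2].
  have m1 : (m < 1) by rewrite -(ltrz1 R); lra.
  have m2 : (-1 < m) by rewrite -(ltr_int R)/=; lra.
  lia.
rewrite m0; split => //; move: pqa; rewrite m0 addr0.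
by case: (ltgtP p q) => // /squeeze_incr; lra.
Qed.

End Squeeze.

Section Foliation.
Variables (R : realType) (f g : T2 R -> T2 R) (F : R * R -> R * R).
Variables (H : R * R -> R) (K alpha : R).
Hypothesis gK : cancel g f.
Hypothesis Fl : plane_lift f F.
Hypothesis K0 : 0 <= K.
Hypothesis cH : continuous H.
Hypothesis H_shift : forall x y a b, a \is a Num.int -> b \is a Num.int ->
  H (x + a, y + b) = H (x, y) + b.
Hypothesis H_lip : forall x y x' y', y + K * `|x' - x| <= y' ->
  H (x, y) <= H (x', y').
Hypothesis H_incr : forall x y1 y2, y1 < y2 -> H (x, y1) < H (x, y2).
Hypothesis HF : forall z, H (F z) = H z + alpha.

Let phi s x : R := xget 0 [set y | H (x, y) = s].

Let phiP s x : H (x, phi s x) = s.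
Proof.
have Hn b : b \is a Num.int -> H (x, b) = H (x, 0) + b.
  by move=> bz; have := H_shift x 0 (int_num0 R) bz; rewrite addr0 add0r.
have [a az /andP[a1 a2]] := ceil_bounds (s - H (x, 0)).
have az1 : a - 1 \is a Num.int by rewrite rpredB ?int_num1.
have c1 : continuous (fun y => H (x, y)).
  apply: continuous_comp2 cH; apply: continuous_pair => ?; first exact: cvg_cst.
  exact: cvg_id.
have aa : a - 1 <= a by lra.
have [||y _ yE] := @IVT R (fun y => H (x, y)) (a - 1) a s aa.
- by apply: continuous_subspaceT.
- by rewrite (Hn _ az) (Hn _ az1) ge_min le_max; apply/andP; split; apply/orP; [left|right]; lra.
by rewrite /phi; case: xgetP => [y' _ //|/(_ y)].
Qed.

Let phi_uniq x y : phi (H (x, y)) x = y.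
Proof.
have := phiP (H (x, y)) x.
by case: (ltgtP (phi (H (x, y)) x) y) => // /(H_incr x) h e; rewrite e ltxx in h.
Qed.

Let phi_lip s x x' : `|phi s x - phi s x'| <= K * `|x - x'|.
Proof.
have h u v : phi s v <= phi s u + K * `|v - u|.
  rewrite leNgt; apply/negP => /(H_incr v); rewrite phiP.
  have := @H_lip u (phi s u) v _ (lexx _); rewrite phiP; lra.
by have := h x x'; have := h x' x; rewrite [`|x' - x|]distrC ler_norml; lra.
Qed.

Let phi_shift s x a b : a \is a Num.int -> b \is a Num.int ->
  phi (s + b) (x + a) = phi s x + b.
Proof. by move=> az bz; rewrite -{1}(phiP s x) -(H_shift _ _ az bz) phi_uniq. Qed.

Let continuous_slice (T : topologicalType) (h : R * R -> T) u :
  continuous h -> continuous (fun x => h (x, u)).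
Proof.
move=> ch; have cu : continuous (fun x : R => (x, u)).
  by apply: continuous_pair => ?; [exact: cvg_id|exact: cvg_cst].
exact: continuous_comp2 cu ch.
Qed.

(** An implicit function theorem by monotonicity: with y fixed slightly below or above the curve,
    the sign of [H (x, y) - s] persists for nearby [x] and [s] and traps [phi]. *)
Let continuous_phi : continuous (fun z : R * R => phi z.2 z.1).
Proof.
move=> [x0 s0] /=; apply/cvgrPdist_lt => e e0; set y0 := phi s0 x0.
have cy (y : R) : continuous (fun z : R * R => H (z.1, y) - z.2).
  move=> z; apply: cvgB; last exact: cvg_snd.
  have cz : continuous (fun z : R * R => (z.1, y)).
    by apply: continuous_pair => ?; [exact: cvg_fst|exact: cvg_cst].
  exact: continuous_comp2 cz cH z.
have h1 : H (x0, y0 - e) - s0 < 0.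
  rewrite subr_lt0 -(phiP s0 x0); apply: H_incr; rewrite -/y0; lra.
have h2 : 0 < H (x0, y0 + e) - s0.
  rewrite subr_gt0 -(phiP s0 x0); apply: H_incr; rewrite -/y0; lra.
have n1 : \forall z \near (x0, s0), H (z.1, y0 - e) - z.2 < 0.
  by have := cy (y0 - e) (x0, s0) _ (open_nbhs_nbhs (conj (@open_lt R 0) h1)).
have n2 : \forall z \near (x0, s0), 0 < H (z.1, y0 + e) - z.2.
  by have := cy (y0 + e) (x0, s0) _ (open_nbhs_nbhs (conj (@open_gt R 0) h2)).
apply: filterS2 n1 n2 => -[x s] /= l1 l2.
rewrite ltr_norml; apply/andP; split.
  suff : phi s x < y0 + e by lra.
  rewrite ltNge; apply/negP; rewrite le_eqVlt => /orP[/eqP yE|/(H_incr x)].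
    by rewrite yE phiP in l2; lra.
  by rewrite phiP; lra.
suff : y0 - e < phi s x by lra.
rewrite ltNge; apply/negP; rewrite le_eqVlt => /orP[/eqP yE|/(H_incr x)].
  by rewrite -yE phiP in l1; lra.
by rewrite phiP; lra.
Qed.

(** [H] modulo 1 is invariant under deck translations and so descends to the torus. *)
Let hT (p : T2 R) : T1 R := piT1 (H (repr p.1, repr p.2)).

Let hT_piT2 z : hT (piT2 z) = piT1 (H z).
Proof.
have [|a [b [az bz zE]]] := (piT2_eqP (repr (piT1 z.1), repr (piT1 z.2)) z).1.
  by rewrite /piT2 /piT1/= !reprK.
by rewrite /hT/= zE H_shift// -surjective_pairing piT1_int.
Qed.

(** Levels of [H] differing by an integer are vertical translates of each other, so a fibre of [hT]
    is one curve on the torus. *)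
Let L p : set (T2 R) := [set q | hT q = hT p].

Let hT_f p : hT (f p) = hT p + piT1 alpha.
Proof.
by have [z <-] := piT2_surj p; rewrite -Fl.2 !hT_piT2 HF piT1D.
Qed.

Let leaf_point s x : hT (piT2 (x, phi s x)) = piT1 s.
Proof. by rewrite hT_piT2 phiP. Qed.

Let leaf_rep s p : hT p = piT1 s -> exists x, p = piT2 (x, phi s x).
Proof.
have [[x y] <-] := piT2_surj p; rewrite hT_piT2 => /piT1_eqP sz; exists x.
have := phi_shift s x (int_num0 R) sz; rewrite addr0 addrC subrK phi_uniq => ->.
by rewrite /piT2/= piT1_int.
Qed.

Let continuous_leaf s : continuous (fun x => piT2 (x, phi s x)).
Proof.
apply: (@continuous_comp2 _ _ _ (fun x => (x, phi s x)) _ _ (@continuous_piT2 R)).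
apply: continuous_pair => x; first exact: cvg_id.
exact: (continuous_slice continuous_phi).
Qed.

Let leaf_path p q : L p q -> exists c : R -> T2 R,
  [/\ {within `[0, 1], continuous c}, c 0 = p, c 1 = q &
      forall t, 0 <= t <= 1 -> L p (c t)].
Proof.
move=> Lpq; have [s sE] := piT1_surj (hT p).
have [x xE] := leaf_rep (esym sE).
have [x' x'E] : exists x', q = piT2 (x', phi s x') by apply: leaf_rep; rewrite Lpq.
exists (fun t => piT2 (x + t * (x' - x), phi s (x + t * (x' - x)))); split.
- apply: continuous_subspaceT.
  have cx : continuous (fun t : R => x + t * (x' - x)).
    by move=> t; apply: cvgD; [exact: cvg_cst|apply: cvgM; [exact: cvg_id|exact: cvg_cst]].
  exact: continuous_comp2 cx (@continuous_leaf s).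
- by rewrite mul0r addr0.
- by rewrite mul1r addrC subrK.
- by move=> t _; rewrite /L/= leaf_point sE.
Qed.

(** The coordinates are x and the level, squeezed into windows of length 1/2: this makes the chart
    injective modulo deck translations and lets a leaf meet it at one level only. The trace of a
    leaf is thus a single horizontal line, already connected. Openness holds because [Psi] has the
    continuous inverse (x, y) -> (x, H (x, y)). *)
Let leaf_chart p : exists psi : R * R -> T2 R,
  [/\ continuous psi, injective psi, forall V, open V -> open (psi @` V),
      range psi p &
      forall q, connected_component (L (psi q) `&` range psi) (psi q) =
        psi @` [set q' | q'.2 = q.2]].
Proof.
have [[x0 y0] pE] := piT2_surj p; pose s0 := H (x0, y0).
pose sq (u q : R) := u + squeeze q.
have csq u : continuous (sq u).
  by move=> q; apply: cvgD; [exact: cvg_cst|exact: continuous_squeeze].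
have osq u : open_map (sq u).
  by apply: open_map_incr => // x y /squeeze_incr; rewrite /sq; lra.
pose Psi (z : R * R) := (z.1, phi z.2 z.1).
have cPsi : continuous Psi by apply: continuous_pair => // z; exact: cvg_fst.
have oPsi : open_map Psi.
  move=> V Vo; rewrite (_ : Psi @` V = (fun z => (z.1, H z)) @^-1` V).
    by apply: open_comp => // z _; apply: continuous_pair => // ?; exact: cvg_fst.
  apply/seteqP; split=> [_ [z Vz <-]|[x y] /= Vz].
    by rewrite /= phiP -surjective_pairing.
  by exists (x, H (x, y)) => //; rewrite /Psi/= phi_uniq.
pose sq2 (q : R * R) := (sq x0 q.1, sq s0 q.2).
pose psi q := piT2 (Psi (sq2 q)).
have psi_int q q' : hT (psi q) = hT (psi q') -> q.2 = q'.2.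
  rewrite !leaf_point => /piT1_eqP; rewrite /sq2/= /sq => dz.
  by have [] := @squeeze_inj_int R q.2 q'.2 _ dz; [ring|].
have cpsi : continuous psi.
  apply: continuous_comp2 (@continuous_piT2 R).
  by apply: continuous_comp2 cPsi; exact: continuous_prod.
exists psi; split => //.
- move=> [q1 q2] [q1' q2'] qq'.
  have /= e2 := psi_int _ _ (congr1 hT qq'); rewrite -{}e2 in qq' *.
  have [/piT1_eqP dz _] := qq'.
  have [|<- _] // := @squeeze_inj_int R q1 q1' _ dz; rewrite /sq2 /sq/=; ring.
- have := open_map_comp (open_map_comp (open_map_prod (osq x0) (osq s0)) oPsi) (@open_piT2 R).
  by [].
- exists (0, 0) => //; rewrite /psi /sq2 /sq/= /squeeze !mul0r !addr0.
  by rewrite /Psi/= phi_uniq.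
- move=> q; have LE : L (psi q) `&` range psi = psi @` [set q' | q'.2 = q.2].
    apply/seteqP; split=> [r [Lr [q' _ qr]]|_ [q' /= q'2 <-]].
      by exists q' => //=; apply: psi_int; rewrite qr.
    split; last by exists q'.
    by rewrite /L/= !leaf_point /sq2/= q'2.
  rewrite LE connected_component_id//; first by exists q.
  rewrite (_ : psi @` _ = (fun t => psi (t, q.2)) @` setT).
    apply: connected_continuous_connected.
      by apply/connected_intervalP.
    apply: continuous_subspaceT.
    exact: continuous_slice cpsi.
  apply/seteqP; split=> [_ [[t u] /= -> <-]|_ [t _ <-]]; first by exists t.
  by exists (t, q.2).
Qed.

(** Real-valued rather than circle-valued, so that scaling it to 0 gives the homotopy from the leaf
    to the horizontal circle. *)
Let leaf_fun s (t : T1 R) : R := phi s (repr t).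

Let leaf_funE s x : leaf_fun s (piT1 x) = phi s x.
Proof.
have /piT1_eqP xz : piT1 (repr (piT1 x)) = piT1 x by rewrite /piT1 reprK.
have := phi_shift s x xz (int_num0 R).
by rewrite !addr0 addrC subrK.
Qed.

Let continuous_leaf_fun s : continuous (leaf_fun s).
Proof.
apply: continuous_T1; rewrite (_ : (fun x => _) = phi s).
  exact: (continuous_slice continuous_phi).
by apply/funext => x; rewrite leaf_funE.
Qed.

Let leafE s p : hT p = piT1 s ->
  L p = [set (t, piT1 (leaf_fun s t)) | t in setT].
Proof.
move=> ps; apply/seteqP; split=> [q Lq|_ [t _ <-]].
  have [|x ->] := @leaf_rep s q; first by rewrite Lq.
  by exists (piT1 x) => //; rewrite leaf_funE.
by have [x <-] := piT1_surj t; rewrite leaf_funE /L/= ps; exact: leaf_point.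
Qed.

Let leaf_curve p : simple_closed_curve_10 (L p).
Proof.
have [s sE] := piT1_surj (hT p).
have cl : continuous (fun t => piT1 (leaf_fun s t)).
  exact: continuous_comp2 (@continuous_leaf_fun s) (@continuous_piT1 R).
exists (fun t => (t, piT1 (leaf_fun s t))); split.
- by apply: continuous_pair => // t; exact: cvg_id.
- by move=> t t' [].
- by rewrite (leafE (esym sE)).
exists (fun z => (z.2, piT1 ((1 - z.1) * leaf_fun s z.2))); split.
- have cm : continuous (fun z : R * T1 R => (1 - z.1) * leaf_fun s z.2).
    move=> z; apply: cvgM; first by apply: cvgB; [exact: cvg_cst|exact: cvg_fst].
    by apply: (@continuous_comp _ _ _ snd (leaf_fun s));
      [exact: cvg_snd|exact: continuous_leaf_fun].
  apply: continuous_subspaceT; apply: continuous_pair => [z|]; first exact: cvg_snd.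
  exact: continuous_comp2 cm (@continuous_piT1 R).
- by move=> t; rewrite /= subr0 mul1r.
- by move=> t; rewrite /= subrr mul0r piT1_0.
Qed.

(** Representatives [a], [b] of x-coordinates yield representatives [phi s a], [phi s b] of their
    images, so the infima compare. [K + 1] replaces [K], which may be 0, to have a positive
    constant. *)
Let leaf_lipschitz p : lipschitz_graph (K + 1) (L p).
Proof.
have [s sE] := piT1_surj (hT p).
exists (fun t => piT1 (leaf_fun s t)); last exact: leafE.
move=> x y; rewrite /distT1.
have K1 : 0 < K + 1 by rewrite ltr_wpDl.
rewrite mulrC -ler_pdivrMr//; apply: lb_le_inf.
  have [a aE] := piT1_surj x; have [b bE] := piT1_surj y.
  by exists `|a - b|, a => //; exists b.
move=> _ [a /= <-] [b /= <-] <-.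
rewrite ler_pdivrMr// !leaf_funE mulrC.
apply: (@le_trans _ _ `|phi s a - phi s b|).
  apply: ge_inf; first by exists 0 => _ [? _ [? _ <-]].
  by exists (phi s a) => //; exists (phi s b).
apply: le_trans (phi_lip _ _ _) _.
by rewrite ler_wpM2r// lerDl.
Qed.

Lemma invariant_foliation_of_height : invariant_foliation f.
Proof.
exists (K + 1), L; split => //.
- by rewrite ltr_wpDl.
- split; [by []| |exact: leaf_path|exact: leaf_chart].
  by move=> z w Lzw; apply/seteqP; split=> q; rewrite /L/= Lzw.
- move=> z; apply/seteqP; split=> [_ [w Lw <-]|w Lw].
    by rewrite /L/= !hT_f Lw.
  exists (g w); last exact: gK.
  by move: Lw; rewrite /L/= -{1}(gK w) !hT_f => /addIr.
Qed.

End Foliation.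

Theorem theorem1 (R : realType) (f : T2 R -> T2 R)
    (fhat : T1 R * R -> T1 R * R) (alpha : R)
    (f_tw : Diff1_tw f) (f_area : area_preserving f)
    (fhat_lift : cylinder_lift f fhat)
    (alpha_irr : irrational alpha) (rho_alpha : rhoV fhat = [set alpha]) :
  invariant_foliation f.
Proof.
have [F [H [K [Fl K0 cH [Hs Hl Hi HF]]]]] :=
  plane_height f_tw f_area fhat_lift alpha_irr rho_alpha.
have [[_ [g [_ gK _]]] _] := f_tw.
exact: invariant_foliation_of_height gK Fl K0 cH Hs Hl Hi HF.
Qed.
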